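(* Let $\alpha\in[1,2)$. There exist positive constants $\mathrm{F}_1,\dots,\mathrm{F}_5$, depending only on $\alpha$ (with the explicit values listed in the context), such that the following holds. Let $\nu$ be a symmetric Lévy measure having a density $f$ with respect to the Lebesgue measure with $f\in\mathscr L_{M,\alpha}$ for some $M>0$, and let $X$ be the associated pure-jump Lévy process. Let $\varepsilon>0$ and assume that $f$ is $M(\varepsilon\wedge1)^{-(2+\alpha)}$-Lipschitz on the interval $\big(\tfrac34(\varepsilon\wedge1),\,2\varepsilon-\tfrac34(\varepsilon\wedge1)\big)$. Then for all $0<t\leq\frac{(2-\alpha)(1\wedge\varepsilon)^\alpha}{2^{1+\alpha}M}$, $$|\mathbb{P}(|X_t|>\varepsilon)-\lambda_\varepsilon t|\leq t^2M^2\Big(\big(\mathrm{F}_1\varepsilon^{-2\alpha}+\lambda_1\varepsilon^{-\alpha}\mathrm{F}_2\big)\mathbf 1_{0<\varepsilon\leq1}+\big(\varepsilon^2\mathrm{F}_3+\mathrm{F}_4\big)\mathbf 1_{\varepsilon>1}\Big)+2t^2\lambda_1^2+\frac{t^4M^4\mathrm{F}_5}{(\varepsilon\wedge1)^{4\alpha}}.$$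
   Context: A Lévy measure is a Borel measure $\nu$ on $\mathbb{R}$ with $\nu(\{0\})=0$ and $\int_{\mathbb{R}}(y^2\wedge 1)\nu(dy)<\infty$; $a\wedge b=\min(a,b)$. $X$ is the Lévy process with Lévy measure $\nu$, no Gaussian part and no drift: since $\nu$ is symmetric, $\mathbb{E}[e^{iuX_t}]=\exp\big(t\int(\cos(ux)-1)\nu(dx)\big)$. For $a>0$, $\lambda_a:=\int_{|x|>a}f(x)dx$. For $M>0$ and $\alpha\in(0,2)$, $\mathscr L_{M,\alpha}$ is the class of functions $f$ with $f(x)\leq M|x|^{-(1+\alpha)}$ for all $0<|x|\leq 2$. Explicit values of the constants. Put $$\mathrm{K}_1=4^{1+\alpha}\Big(\frac{e^{2+1/e}}{(2-\alpha)^2}+\frac{1}{\alpha^2}\Big),\quad \mathrm{K}_3=\frac{2^{3(1+\alpha)}e^{3+1/e}}{\alpha(2-\alpha)^3},\quad \mathrm{K}_6=\frac{2^{2\alpha+1}}{3^\alpha(2-\alpha)},$$ and, for $\alpha\in(1,2)$, $$\mathrm{K}_2=\frac{2^{1+3\alpha}}{\alpha(2-\alpha)(\alpha-1)},\quad \mathrm{K}_4=\frac{2^{2\alpha-1}}{\alpha(2-\alpha)^2}+\frac{2^{3\alpha}}{\alpha(\alpha-1)(2-\alpha)}+\frac{2^{4\alpha+1}}{21^\alpha\alpha(2-\alpha)}+\frac{2^{2\alpha+2}}{\alpha(2-\alpha)},$$ $$\mathrm{K}_5=\Big(\frac{8(3/4)^{2-\alpha}}{\alpha(2-\alpha)^2}+\frac{2^{3\alpha}}{\alpha(\alpha-1)(2-\alpha)}\Big)\mathbf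 1_{1<\varepsilon<3/2}+\frac{4^{1+\alpha}}{3^\alpha(2-\alpha)}\mathbf 1_{\varepsilon\ge3/2}.$$ For $\alpha\in(1,2)$: $$\mathrm{F}_1=2\mathrm{K}_1+2\mathrm{K}_2+\mathrm{K}_4+\frac{6}{\alpha^2},\quad \mathrm{F}_2=\mathrm{K}_6,\quad \mathrm{F}_3=\mathrm{K}_5,\quad \mathrm{F}_4=2\mathrm{K}_1+2\mathrm{K}_2+\frac{6}{\alpha^2},\quad \mathrm{F}_5=2\mathrm{K}_3$$ ($\mathrm{F}_3$ takes one value for $1<\varepsilon<3/2$ and another for $\varepsilon\ge3/2$). For $\alpha=1$: $\mathrm{F}_2=\mathrm{K}_6$, $\mathrm{F}_4=2\mathrm{K}_1+64\ln2+6/\alpha^2$, $\mathrm{F}_5=2\mathrm{K}_3$, and $\mathrm{F}_1,\mathrm{F}_3$ are unspecified absolute constants. *)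

(* Defs.v *)
From HB Require Import structures.
From mathcomp Require Import all_boot all_order all_algebra.
From mathcomp Require Import complex.
From mathcomp Require Import all_classical all_reals all_analysis.

Set Implicit Arguments.
Unset Strict Implicit.
Unset Printing Implicit Defensive.

Import Order.TTheory GRing.Theory Num.Theory.
Import numFieldNormedType.Exports.

Local Open Scope classical_set_scope.
Local Open Scope ring_scope.

Section LevyProcess.
Context {d : measure_display} {T : measurableType d} {R : realType}.
Variable P : probability T R.

(* The sets [B i] may be [setT], so the product rule for the whole family
   contains the one for every subfamily. *)
Definition mutually_independent n (Y : 'I_n -> T -> R) : Prop :=
  forall B : 'I_n -> set R, (forall i, measurable (B i)) ->
    P (\bigcap_i (Y i @^-1` B i)) = (\prod_(i < n) P (Y i @^-1` B i))%E.

Definition independent_increments (X : R -> T -> R) : Prop :=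
  forall n (t : nat -> R), 0 <= t 0%N ->
    {homo t : i j / (i <= j)%N >-> i <= j} ->
    mutually_independent (fun i : 'I_n => X (t i.+1) \- X (t i)).

Definition stationary_increments (X : R -> T -> R) : Prop :=
  forall s h, 0 <= s -> 0 <= h ->
    forall B : set R, measurable B ->
      P ((X (s + h) \- X s) @^-1` B) = P (X h @^-1` B).

Definition cadlag (x : R -> R) : Prop :=
  (forall t, 0 <= t -> x s @[s --> t^'+] --> x t) /\
  (forall t, 0 < t -> cvg (x s @[s --> t^'-])).

(* Time is the half-line [0 <= t]; the variables [X t] with [t < 0] are junk
   and never constrained. *)
Definition levy_process (X : R -> {RV P >-> R}) : Prop :=
  [/\ {ae P, forall w, X 0 w = 0},
      {ae P, forall w, cadlag (fun t => X t w)},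
      stationary_increments (fun t => X t) &
      independent_increments (fun t => X t)].

(* E[e^(iuY)] = E[cos(uY)] + i E[sin(uY)] *)
Definition char_fun (Y : {RV P >-> R}) (u : R) : R[i] :=
  Complex (\int[P]_w cos (u * Y w)) (\int[P]_w sin (u * Y w)).

(* Pure-jump process with no drift. As [nu] is symmetric, the Levy-Khintchine
   exponent with triplet (0, 0, nu) is the real number
   \int (cos (u y) - 1) nu(dy). *)
Definition pure_jump_levy_process
    (nu : {measure set (measurableTypeR R) -> \bar R})
    (X : R -> {RV P >-> R}) : Prop :=
  levy_process X /\
  forall t u, 0 <= t ->
    char_fun (X t) u =
    real_complex R (expR (t * \int[nu]_y (cos (u * y) - 1))).

End LevyProcess.

Section LevyMeasure.
Context {R : realType}.
Implicit Types (nu : {measure set (measurableTypeR R) -> \bar R}) (f : R -> R).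

Definition levy_measure nu : Prop :=
  nu [set 0] = 0%E /\ (\int[nu]_y (Num.min (y ^+ 2) 1)%:E < +oo)%E.

Definition symmetric_measure nu : Prop :=
  forall A : set R, measurable A -> nu (-%R @` A) = nu A.

Definition has_density nu f : Prop :=
  [/\ measurable_fun setT f, (forall x, 0 <= f x) &
      forall A : set R, measurable A ->
        nu A = (\int[lebesgue_measure]_(x in A) (f x)%:E)%E].

Definition class_L (M alpha : R) : set (R -> R) :=
  [set f | forall x, 0 < `|x| <= 2 -> f x <= M * `|x| `^ (- (1 + alpha))].

Definition lambda f (a : R) : R :=
  \int[lebesgue_measure]_(x in [set x | a < `|x|]) f x.

End LevyMeasure.

Section Constants.
Context {R : realType}.
Implicit Types a eps : R.

Definition K1 a : R :=
  4 `^ (1 + a) * (expR (2 + (expR 1)^-1) / (2 - a) ^+ 2 + 1 / a ^+ 2).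

Definition K2 a : R := 2 `^ (1 + 3 * a) / (a * (2 - a) * (a - 1)).

Definition K3 a : R :=
  2 `^ (3 * (1 + a)) * expR (3 + (expR 1)^-1) / (a * (2 - a) ^+ 3).

Definition K4 a : R :=
  2 `^ (2 * a - 1) / (a * (2 - a) ^+ 2)
  + 2 `^ (3 * a) / (a * (a - 1) * (2 - a))
  + 2 `^ (4 * a + 1) / (21 `^ a * a * (2 - a))
  + 2 `^ (2 * a + 2) / (a * (2 - a)).

Definition K5 a eps : R :=
  (8 * (3 / 4) `^ (2 - a) / (a * (2 - a) ^+ 2)
   + 2 `^ (3 * a) / (a * (a - 1) * (2 - a))) * (1 < eps < 3 / 2)%R%:R
  + 4 `^ (1 + a) / (3 `^ a * (2 - a)) * (3 / 2 <= eps)%R%:R.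

Definition K6 a : R := 2 `^ (2 * a + 1) / (3 `^ a * (2 - a)).

(* [F3] is a function of [eps] because for [1 < a] it takes one value on
   1 < eps < 3/2 and another on 3/2 <= eps; only its values at 1 < eps are
   ever used. For [a = 1], [F1] and [F3] are unspecified constants. *)
Definition explicit_constants a (F1 F2 : R) (F3 : R -> R) (F4 F5 : R) : Prop :=
  [/\ [/\ 0 < F1, 0 < F2, (forall eps, 1 < eps -> 0 < F3 eps), 0 < F4 &
          0 < F5],
      (1 < a ->
       [/\ F1 = 2 * K1 a + 2 * K2 a + K4 a + 6 / a ^+ 2,
           F2 = K6 a,
           (forall eps, 1 < eps -> F3 eps = K5 a eps),
           F4 = 2 * K1 a + 2 * K2 a + 6 / a ^+ 2 &
           F5 = 2 * K3 a]) &
      (a = 1 ->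
       [/\ F2 = K6 a,
           (exists c, forall eps, 1 < eps -> F3 eps = c),
           F4 = 2 * K1 a + 64 * ln 2 + 6 / a ^+ 2 &
           F5 = 2 * K3 a])].

End Constants.

(* Main.v *)
(* Cut the jumps at [eta = min (eps, 1) / 2]. The law of [X t] is a limit of laws
   of random walks with [n] steps, each of which stays put or makes a jump of
   modulus larger than [delta] distributed as [t / n * nu] ([n -> oo],
   [delta -> 0]): their characteristic functions [(1 - t * psi_delta / n) ^ n]
   converge to that of [X t], and trigonometric polynomials approximate the
   indicator of [eps < |x|], so it suffices to bound the walks uniformly.
   The paths of a walk without jump larger than [eta] contribute [O(t ^ 2)] by
   Chernoff's bound, those with at least two such jumps at most
   [(t * lambda_eta) ^ 2 / 2], and those with exactly one contribute
   [t * E (h S)], where [S] is the sum of the small jumps and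
   [h x = nu {y | eta < |y|, eps < |x + y|}]. By symmetry of [nu] and the
   Lipschitz condition, [h x - h 0] is [O(x ^ 2)], while [E S ^ 2 = O(t)] and
   [h 0 = lambda_eps]. AM-GM turns the products of [M] and [lambda_1] into
   squares, which fit in the terms [2 * K1] and [2 * lambda_1 ^ 2]. *)
Require Import Defs.
From HB Require Import structures.
From mathcomp Require Import all_boot all_order all_algebra.
From mathcomp Require Import all_classical all_reals all_analysis.
From mathcomp Require Import measurable_realfun.
From mathcomp Require Import ring lra.
Set Implicit Arguments.
Unset Strict Implicit.
Unset Printing Implicit Defensive.
Import Order.TTheory GRing.Theory Num.Theory.
Import numFieldNormedType.Exports.
Local Open Scope classical_set_scope.
Local Open Scope ring_scope.

(** * Convolution with a finite measure *)

Section Convolution.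
Context {R : realType}.
Implicit Types (m : {finite_measure set (measurableTypeR R) -> \bar R})
  (g h : R -> R).

(** The process enters through the characteristic function of [X t]; jumps are decomposed in the
    walks instead. The walks are never built as random variables: a walk is a positive linear
    operator iterated on bounded measurable functions, and splitting its paths is algebra of
    operators. Symmetric measures make cosines eigenfunctions of these operators, so the limit is
    computed on cosines, which suffice because the event is even. The obstacle is that trigonometric
    polynomials are periodic: they approximate the indicator only on a shell [b <= |x| <= c] with
    [eps < b]. The upper bound therefore truncates the event of [X t], which continuity of [P]
    repairs; the lower bound truncates the test function of the walk, at the price of a quadratic
    error that the second-moment estimate absorbs. The time restriction says exactly that
    [v = t * s2 / eta ^ 2] is at most 1, where [s2] bounds the variance of the small jumps, and all
    error terms are finally expressed through [v], [t * M] and [t * lambda_1]. *)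

Definition bounded_measurable g : Prop :=
  measurable_fun [set: R] g /\ exists K, forall x, `|g x| <= K.

(** Measures act on functions here rather than on measures: [convol m] is the jump operator whose
    iterates replace the law of a walk. *)
Definition convol m g (x : R) : R := \int[m]_y g (x + y).

Lemma bmf_cst c : bounded_measurable (fun=> c).
Proof. by split=> //; exists `|c|. Qed.

Lemma bmfD g h : bounded_measurable g -> bounded_measurable h ->
  bounded_measurable (fun x => g x + h x).
Proof.
move=> [mg [K gK]] [mh [L hL]]; split; first exact: measurable_funD.
by exists (K + L) => x; rewrite (le_trans (ler_normD _ _))// lerD.
Qed.

Lemma bmfM g h : bounded_measurable g -> bounded_measurable h ->
  bounded_measurable (fun x => g x * h x).
Proof.
move=> [mg [K gK]] [mh [L hL]]; split; first exact: measurable_funM.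
by exists (K * L) => x; rewrite normrM ler_pM.
Qed.

Lemma bmfZ c g : bounded_measurable g -> bounded_measurable (fun x => c * g x).
Proof. by move=> bg; exact: bmfM (bmf_cst c) bg. Qed.

Lemma bmfN g : bounded_measurable g -> bounded_measurable (fun x => - g x).
Proof.
move=> [mg [K gK]]; split; first exact: measurable_funN.
by exists K => x; rewrite normrN.
Qed.

Lemma bmf_shift x g : bounded_measurable g ->
  bounded_measurable (fun y => g (x + y)).
Proof.
move=> [mg [K gK]]; split; last by exists K => y.
by apply: (measurableT_comp mg); exact: measurable_funD.
Qed.

Lemma bmf_indic (D : set R) : measurable D ->
  bounded_measurable (\1_D : R -> R).
Proof.
move=> mD; split; first exact: measurable_indic.
by exists 1 => x; rewrite indicE; case: (_ \in _); rewrite ?normr0 ?normr1.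
Qed.

Lemma bmf_cos (u : R) : bounded_measurable (fun x => cos (u * x)).
Proof.
split; last by exists 1 => x; rewrite ler_norml cos_geN1 cos_le1.
apply: measurableT_comp; last exact: measurable_funM.
by apply: continuous_measurable_fun; exact: continuous_cos.
Qed.

Lemma bmf_integrable {d} {T : measurableType d}
    (P : {finite_measure set T -> \bar R}) (X : T -> R) g :
  measurable_fun [set: T] X -> bounded_measurable g ->
  P.-integrable setT (EFin \o (g \o X)).
Proof.
move=> mX [mg [K gK]]; apply: measurable_bounded_integrable => //.
- exact: (fin_num_fun_lty (fin_num_measure P)).
- exact: measurableT_comp.
- exists K; split; first by rewrite num_real.
  by move=> y Ky x _ /=; rewrite (le_trans (gK _))// ltW.
Qed.

Lemma bmf_integrable_shift m g x : bounded_measurable g ->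
  m.-integrable setT (EFin \o (fun y => g (x + y))).
Proof.
move=> bg.
exact: (@bmf_integrable _ _ m id _ (@measurable_id _ _ _) (bmf_shift x bg)).
Qed.

Lemma convolD m g h x : bounded_measurable g -> bounded_measurable h ->
  convol m (fun y => g y + h y) x = convol m g x + convol m h x.
Proof.
by move=> bg bh; rewrite /convol RintegralD//; exact: bmf_integrable_shift.
Qed.

Lemma convolZ m c g x : bounded_measurable g ->
  convol m (fun y => c * g y) x = c * convol m g x.
Proof.
by move=> bg; rewrite /convol RintegralZl//; exact: bmf_integrable_shift.
Qed.

Lemma convol_cst m c x : convol m (fun=> c) x = c * fine (m setT).
Proof. by rewrite /convol Rintegral_cst. Qed.

Lemma convol_le m g h x : bounded_measurable g -> bounded_measurable h ->
  (forall y, g y <= h y) -> convol m g x <= convol m h x.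
Proof.
by move=> bg bh gh; apply: le_Rintegral => //; exact: bmf_integrable_shift.
Qed.

Let EFin_convol m g x : bounded_measurable g ->
  (convol m g x)%:E = (\int[m]_y (g (x + y))%:E)%E.
Proof.
move=> bg; rewrite /convol /Rintegral fineK//.
exact: (integrable_fin_num _ (bmf_integrable_shift m x bg)).
Qed.

Let measurable_shift2 g : bounded_measurable g ->
  measurable_fun setT (fun z : measurableTypeR R * measurableTypeR R => (g (z.1 + z.2))%:E).
Proof.
move=> [mg _]; apply/measurable_EFinP; apply: (measurableT_comp mg).
exact: measurable_funD.
Qed.

Let convol_bmf_ge0 m g : (forall x, 0 <= g x) -> bounded_measurable g ->
  bounded_measurable (convol m g).
Proof.
move=> g0 bg; split.
  apply/measurable_EFinP.
  rewrite (_ : EFin \o _ = fun x => \int[m]_y (g (x + y))%:E)%E; last first.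
    by apply/funext => x /=; rewrite EFin_convol.
  apply: (measurable_fun_fubini_tonelli_F
    (fun z : measurableTypeR R * measurableTypeR R => (g (z.1 + z.2))%:E)).
    exact: measurable_shift2.
  by move=> z; rewrite lee_fin.
have [mg [K gK]] := bg.
exists (K * fine (m setT)) => x.
rewrite ger0_norm; last by apply: Rintegral_ge0.
rewrite -(convol_cst m K x); apply: convol_le => //; first exact: bmf_cst.
by move=> y; rewrite (le_trans (ler_norm _)).
Qed.

Let bmf_ge0 g : bounded_measurable g -> exists K h,
  [/\ bounded_measurable h, forall x, 0 <= h x & g = fun x => h x + K].
Proof.
move=> [mg [K gK]]; exists (- K), (fun x => g x + K); split.
- by apply: bmfD (bmf_cst K); split=> //; exists K.
- by move=> x; have := gK x; rewrite ler_norml => /andP[]; lra.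
- by apply/funext => x; rewrite addrK.
Qed.

Lemma convol_bmf m g : bounded_measurable g -> bounded_measurable (convol m g).
Proof.
move=> /bmf_ge0[K [h [bh h0 ->]]].
rewrite (_ : convol _ _ = fun x => convol m h x + K * fine (m setT)).
  by apply: bmfD (bmf_cst _); exact: convol_bmf_ge0.
by apply/funext => x; rewrite convolD//; [rewrite convol_cst|exact: bmf_cst].
Qed.

(** Tonelli's theorem and commutativity of addition. *)
Lemma convolC m1 m2 g x : bounded_measurable g ->
  convol m1 (convol m2 g) x = convol m2 (convol m1 g) x.
Proof.
move=> /bmf_ge0[K [h [bh h0 ->]]].
have E m m' : convol m (convol m' (fun x => h x + K)) x =
    convol m (convol m' h) x + K * fine (m' setT) * fine (m setT).
  rewrite -(convol_cst m _ x) -convolD; first last.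
  - exact: bmf_cst.
  - exact: convol_bmf.
  congr (convol _ _ _); apply/funext => y.
  by rewrite convolD//; [rewrite convol_cst|exact: bmf_cst].
rewrite !E mulrAC; congr (_ + _).
apply: EFin_inj; rewrite !EFin_convol; try exact: convol_bmf.
under eq_integral do rewrite EFin_convol//.
under [RHS]eq_integral do rewrite EFin_convol//.
rewrite (fubini_tonelli (fun z : measurableTypeR R * measurableTypeR R => (h (x + z.1 + z.2))%:E)).
- by under eq_integral do under eq_integral do rewrite addrAC.
- apply/measurable_EFinP; apply: (measurableT_comp (proj1 bh)).
  by apply: measurable_funD => //; exact: measurable_funD.
- by move=> z; rewrite lee_fin.
Qed.

End Convolution.

(** * Integrals against symmetric measures *)

Section SymmetricMeasure.
Context {R : realType}.

Lemma symmetric_integral (m : {measure set (measurableTypeR R) -> \bar R}) (g : R -> \bar R) :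
  symmetric_measure m -> measurable_fun setT g -> (forall x, 0 <= g x)%E ->
  (\int[m]_y g (- (y : R))%R = \int[m]_y g y)%E.
Proof.
move=> sm mg g0.
have mopp : measurable_fun (setT : set (measurableTypeR R)) (-%R : measurableTypeR R -> measurableTypeR R).
  exact: measurable_funN.
transitivity (\int[pushforward m (-%R : measurableTypeR R -> measurableTypeR R)]_y g y)%E.
  by rewrite [RHS]ge0_integral_pushforward.
apply: eq_measure_integral => A mA _.
rewrite /pushforward -[RHS]sm//; congr (m _).
apply/seteqP; split => [x Ax|_ [x Ax <-]].
  by exists (- x) => //; rewrite opprK.
by rewrite /preimage /= opprK.
Qed.

Lemma symmetric_Rintegral (m : {measure set (measurableTypeR R) -> \bar R}) (g : R -> R) :
  symmetric_measure m -> m.-integrable setT (EFin \o g) ->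
  \int[m]_y g (- y) = \int[m]_y g y.
Proof.
move=> sm ig; have /measurable_EFinP mg := measurable_int _ ig.
rewrite /Rintegral; congr fine.
have mEg : measurable_fun setT (EFin \o g) by exact/measurable_EFinP.
rewrite integralE [RHS]integralE; congr (_ - _)%E.
  transitivity (\int[m]_y ((EFin \o g)^\+ (- (y : R))%R))%E; first by apply: eq_integral => y _; rewrite ?funeposE ?funenegE.
  by rewrite (symmetric_integral sm (measurable_funepos mEg)).
transitivity (\int[m]_y ((EFin \o g)^\- (- (y : R))%R))%E; first by apply: eq_integral => y _; rewrite ?funeposE ?funenegE.
by rewrite (symmetric_integral sm (measurable_funeneg mEg)).
Qed.

Lemma Rintegral_odd (m : {measure set (measurableTypeR R) -> \bar R}) (g : R -> R) :
  symmetric_measure m -> m.-integrable setT (EFin \o g) ->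
  (forall y, g (- y) = - g y) -> \int[m]_y g y = 0.
Proof.
move=> sm ig godd.
have : \int[m]_y g y = - \int[m]_y g y.
  rewrite -[LHS](symmetric_Rintegral sm)//.
  under eq_Rintegral do rewrite godd -mulN1r.
  by rewrite RintegralZl// mulN1r.
lra.
Qed.

(** Serves unbounded integrands such as [y ^+ 2] and [cosh (u * y)]: the measure of small jumps is
    finite and carried by [|y| <= eta]. *)
Lemma ae_bounded_integrable (m : {finite_measure set (measurableTypeR R) -> \bar R})
    (eta K : R) (g : R -> R) :
  {ae m, forall y, `|y| <= eta} -> measurable_fun setT g ->
  (forall y, `|y| <= eta -> `|g y| <= K) ->
  m.-integrable setT (EFin \o g).
Proof.
move=> aem mg gK; apply/integrableP; split; first exact/measurable_EFinP.
have foo : (m setT < +oo)%E by exact: (fin_num_fun_lty (fin_num_measure m)).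
apply: (@le_lt_trans _ _ (`|K|%:E * m setT)%E).
  apply: integral_le_bound => //.
    by apply/measurable_EFinP.
  move: aem; apply: (@filterS _ _ (ae_filter_ringOfSetsType m)) => y /gK gy _ /=.
  by rewrite lee_fin (le_trans gy)// ler_norm.
by rewrite lte_mul_pinfty.
Qed.

End SymmetricMeasure.

(** * Hyperbolic functions for the Chernoff bound *)

Section Cosh.
Context {R : realType}.
Implicit Types x y s z : R.

(** Preferred to the exponential as exponential moment: it is even, so one function controls both
    tails, and a symmetric step multiplies its mean by a constant. *)
Definition cosh x : R := (expR x + expR (- x)) / 2.
Definition sinh x : R := (expR x - expR (- x)) / 2.

Lemma coshD x y : cosh (x + y) = cosh x * cosh y + sinh x * sinh y.
Proof. by rewrite /cosh /sinh opprD !expRD; field. Qed.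

Lemma cosh_gt0 x : 0 < cosh x.
Proof. by rewrite /cosh divr_gt0// addr_gt0 ?expR_gt0. Qed.

Lemma cosh_ge_expR x : expR x / 2 <= cosh x.
Proof. by rewrite /cosh ler_pM2r// lerDl expR_ge0. Qed.

Lemma coshN x : cosh (- x) = cosh x.
Proof. by rewrite /cosh opprK addrC. Qed.

Lemma sinhN x : sinh (- x) = - sinh x.
Proof. by rewrite /sinh opprK -mulNr opprB. Qed.

Lemma ler_cosh x y : 0 <= x -> x <= y -> cosh x <= cosh y.
Proof.
move=> x0 xy; rewrite /cosh ler_pM2r// !expRN.
have ex : 1 <= expR x by rewrite -expR0 ler_expR.
have exy : expR x <= expR y by rewrite ler_expR.
have ex0 : 0 < expR x by exact: expR_gt0.
have ey0 : 0 < expR y by exact: expR_gt0.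
rewrite -subr_ge0.
have -> : expR y + (expR y)^-1 - (expR x + (expR x)^-1) =
  (expR y - expR x) * (expR x * expR y - 1) / (expR x * expR y).
  by field; rewrite !gt_eqF.
by rewrite divr_ge0 ?mulr_ge0 ?subr_ge0 ?mulr_ege1 // ?(le_trans ex)// ltW.
Qed.

Lemma cosh_norm x : cosh `|x| = cosh x.
Proof. by case: (ger0P x) => // _; rewrite coshN. Qed.

(** Convexity of [sinh] on the half-line: the derivative of [z * sinh r - sinh (z * r)] in [r] is
    [z * (cosh r - cosh (z * r))], which is nonnegative. *)
Lemma ler_sinh_scale z s : 0 <= z <= 1 -> 0 <= s -> sinh (z * s) <= z * sinh s.
Proof.
move=> /andP[z0 z1] s0.
pose h (r : R) := z * sinh r - sinh (z * r).
have dh r : is_derive r (1 : R) h (z * cosh r - z * cosh (z * r)).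
  rewrite /h /sinh /cosh; apply: is_derive_eq.
  by rewrite /GRing.scale /=; ring.
suff : h 0 <= h s by rewrite /h mulr0 /sinh oppr0 subrr mul0r mulr0 subr0 subr_ge0.
apply: (@ger0_derive1_le_cc _ h 0 s) => //.
- move=> x; rewrite in_itv/= => /andP[x0 _].
  rewrite derive1E derive_val -mulrBr mulr_ge0// subr_ge0 ler_cosh ?mulr_ge0 ?(ltW x0)//.
  by rewrite ler_piMl ?(ltW x0).
- apply: continuous_subspaceT => x.
  by apply: differentiable_continuous; exact/derivable1_diffP.
- by rewrite in_itv/= lexx.
- by rewrite in_itv/= s0 lexx.
Qed.

Lemma cosh_half x : cosh x - 1 = 2 * sinh (x / 2) ^+ 2.
Proof.
rewrite /cosh /sinh !expRN.
have -> : expR x = expR (x / 2) * expR (x / 2) by rewrite -expRD -splitr.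
have : expR (x / 2) != 0 by rewrite gt_eqF ?expR_gt0.
by move=> ?; field.
Qed.

(** The quotient [(cosh z - 1) / z ^+ 2] grows with [|z|]; by [cosh_half] this reduces to
    [ler_sinh_scale]. It bounds the exponential moment of the small jumps by their variance. *)
Lemma cosh_sub1_le z s : `|z| <= s -> 0 < s ->
  cosh z - 1 <= z ^+ 2 / s ^+ 2 * (cosh s - 1).
Proof.
move=> zs s0; rewrite -(cosh_norm z) -(real_normK (num_real z)).
have /ler_sinh_scale : 0 <= `|z| / s <= 1.
  by rewrite divr_ge0 ?(ltW s0)//= ler_pdivrMr// mul1r.
move=> /(_ (s / 2)); rewrite divr_ge0 ?(ltW s0)// => /(_ isT).
have -> : `|z| / s * (s / 2) = `|z| / 2 by field; rewrite gt_eqF.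
move=> H; rewrite !cosh_half.
have -> : `|z| ^+ 2 / s ^+ 2 * (2 * sinh (s / 2) ^+ 2) = 2 * (`|z| / s * sinh (s / 2)) ^+ 2.
  by field; rewrite gt_eqF.
rewrite ler_pM2l//; rewrite ler_pXn2r// nnegrE ?(le_trans _ H)//;
  rewrite /sinh divr_ge0// subr_ge0 ler_expR; have := normr_ge0 z; lra.
Qed.

Lemma measurable_cosh : measurable_fun setT cosh.
Proof.
apply: measurable_funM => //; apply: measurable_funD => //.
by apply: measurableT_comp => //; exact: measurable_funN.
Qed.

Lemma measurable_sinh : measurable_fun setT sinh.
Proof.
apply: measurable_funM => //; apply: measurable_funB => //.
by apply: measurableT_comp => //; exact: measurable_funN.
Qed.

End Cosh.

(** * Random walks with small and big jumps *)

Section RandomWalk.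
Context {R : realType} (mS mB : {finite_measure set (measurableTypeR R) -> \bar R}).
Context (p : R).
Implicit Types (g h : R -> R) (n : nat).

Local Notation massS := (fine (mS setT)).
Local Notation massB := (fine (mB setT)).

(* [step g x] is the expectation of [g] after one step of the walk from [x], and
   [step_small g x] its restriction to the event that this step is not big. *)
Definition step_small g (x : R) : R :=
  (1 - p * (massS + massB)) * g x + p * convol mS g x.

Definition step g (x : R) : R := step_small g x + p * convol mB g x.

Lemma step_small_bmf g : bounded_measurable g -> bounded_measurable (step_small g).
Proof. by move=> bg; apply: bmfD; apply: bmfZ => //; exact: convol_bmf. Qed.

Lemma step_bmf g : bounded_measurable g -> bounded_measurable (step g).
Proof.
by move=> bg; apply: bmfD; [exact: step_small_bmf|apply: bmfZ; exact: convol_bmf].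
Qed.

Lemma iter_step_small_bmf n g :
  bounded_measurable g -> bounded_measurable (iter n step_small g).
Proof. by move=> bg; elim: n => //= n; exact: step_small_bmf. Qed.

Lemma iter_step_bmf n g : bounded_measurable g -> bounded_measurable (iter n step g).
Proof. by move=> bg; elim: n => //= n; exact: step_bmf. Qed.

Lemma step_small_lin a g h : bounded_measurable g -> bounded_measurable h ->
  step_small (fun x => g x + a * h x) = (fun x => step_small g x + a * step_small h x).
Proof.
move=> bg bh; apply/funext => x; rewrite /step_small convolD//; last exact: bmfZ.
by rewrite convolZ//; ring.
Qed.

Lemma step_lin a g h : bounded_measurable g -> bounded_measurable h ->
  step (fun x => g x + a * h x) = (fun x => step g x + a * step h x).
Proof.
move=> bg bh; apply/funext => x; rewrite /step step_small_lin//.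
rewrite convolD//; last exact: bmfZ.
by rewrite convolZ//; ring.
Qed.

Lemma iter_step_lin n a g h : bounded_measurable g -> bounded_measurable h ->
  iter n step (fun x => g x + a * h x) = (fun x => iter n step g x + a * iter n step h x).
Proof.
by move=> bg bh; elim: n => //= n ->; rewrite step_lin//; exact: iter_step_bmf.
Qed.

Lemma iter_step_small_lin n a g h : bounded_measurable g -> bounded_measurable h ->
  iter n step_small (fun x => g x + a * h x) =
  (fun x => iter n step_small g x + a * iter n step_small h x).
Proof.
by move=> bg bh; elim: n => //= n ->; rewrite step_small_lin//; exact: iter_step_small_bmf.
Qed.

(** The restricted walk is sub-Markov: each step loses the probability [p * massB] of a big jump. *)
Lemma step_small_cst c : step_small (fun=> c) = (fun=> (1 - p * massB) * c).
Proof. by apply/funext => x; rewrite /step_small convol_cst; ring. Qed.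

Lemma iter_step_small_cst n c :
  iter n step_small (fun=> c) = (fun=> (1 - p * massB) ^+ n * c).
Proof.
by elim: n => [|n IH] /=; rewrite ?expr0 ?mul1r// IH step_small_cst mulrA exprS.
Qed.

Lemma step_cst c : step (fun=> c) = (fun=> c).
Proof. by apply/funext => x; rewrite /step step_small_cst convol_cst; ring. Qed.

Lemma iter_step_cst n c : iter n step (fun=> c) = (fun=> c).
Proof. by elim: n => //= n ->; exact: step_cst. Qed.

Lemma step_small_convolC m g : bounded_measurable g ->
  step_small (convol m g) = convol m (step_small g).
Proof.
move=> bg; apply/funext => x; rewrite /step_small convolD; last 2 first.
- exact: bmfZ.
- by apply: bmfZ; exact: convol_bmf.
rewrite !convolZ//; last exact: convol_bmf.
by rewrite convolC.
Qed.

(** Lets a big jump be moved from any position of the walk to a fixed one, so that all positions of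
    a single big jump contribute the same amount. *)
Lemma iter_step_small_convolC n m g : bounded_measurable g ->
  iter n step_small (convol m g) = convol m (iter n step_small g).
Proof.
move=> bg; elim: n => //= n ->; rewrite step_small_convolC//.
exact: iter_step_small_bmf.
Qed.

Context (p0 : 0 <= p) (pmass : p * (massS + massB) <= 1).

Let massB0 : 0 <= massB. Proof. exact: fine_ge0. Qed.
Let massS0 : 0 <= massS. Proof. exact: fine_ge0. Qed.

Let pB1 : p * massB <= 1.
Proof. by rewrite (le_trans _ pmass)// ler_wpM2l// lerDr. Qed.

(** [pmass] makes the probability [1 - p * (massS + massB)] of staying put nonnegative, hence the
    operator positive. *)
Lemma step_small_le g h : bounded_measurable g -> bounded_measurable h ->
  (forall x, g x <= h x) -> forall x, step_small g x <= step_small h x.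
Proof.
move=> bg bh gh x; rewrite lerD// ler_wpM2l ?subr_ge0//.
exact: convol_le.
Qed.

Lemma step_le g h : bounded_measurable g -> bounded_measurable h ->
  (forall x, g x <= h x) -> forall x, step g x <= step h x.
Proof.
move=> bg bh gh x; rewrite lerD//; first exact: step_small_le.
by rewrite ler_wpM2l//; exact: convol_le.
Qed.

Lemma iter_step_small_le n g h : bounded_measurable g -> bounded_measurable h ->
  (forall x, g x <= h x) -> forall x, iter n step_small g x <= iter n step_small h x.
Proof.
move=> bg bh gh; elim: n => //= n IH x.
by apply: step_small_le => //; exact: iter_step_small_bmf.
Qed.

Lemma iter_step_le n g h : bounded_measurable g -> bounded_measurable h ->
  (forall x, g x <= h x) -> forall x, iter n step g x <= iter n step h x.
Proof.
move=> bg bh gh; elim: n => //= n IH x.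
by apply: step_le => //; exact: iter_step_bmf.
Qed.

Lemma iter_step_small_le_cst n g c : bounded_measurable g -> 0 <= c ->
  (forall x, g x <= c) -> forall x, iter n step_small g x <= c.
Proof.
move=> bg c0 gc x; rewrite (le_trans (iter_step_small_le n bg (bmf_cst c) gc x))//.
by rewrite iter_step_small_cst ler_piMl// exprn_ile1 ?subr_ge0// gerBl mulr_ge0.
Qed.

Lemma iter_step_small_ge0 n g : bounded_measurable g ->
  (forall x, 0 <= g x) -> forall x, 0 <= iter n step_small g x.
Proof.
move=> bg g0 x; have := iter_step_small_le n (bmf_cst 0) bg g0 x.
by rewrite iter_step_small_cst mulr0.
Qed.

Lemma convol_le_cst m g c : bounded_measurable g ->
  (forall x, g x <= c) -> forall x, convol m g x <= c * fine (m setT).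
Proof.
move=> bg gc x; rewrite -(convol_cst _ _ x); apply: convol_le => //.
exact: bmf_cst.
Qed.

Lemma convol_ge0 m g : (forall x, 0 <= g x) -> forall x, 0 <= convol m g x.
Proof. by move=> g0 x; exact: Rintegral_ge0. Qed.

Lemma iter_step_ge_small n g : bounded_measurable g -> (forall x, 0 <= g x) ->
  forall x, iter n step_small g x <= iter n step g x.
Proof.
move=> bg g0; elim: n => //= n IH x.
have bS := iter_step_small_bmf n bg; have bP := iter_step_bmf n bg.
apply: (le_trans (step_small_le bS bP IH x)).
rewrite /step lerDl mulr_ge0// convol_ge0// => y.
by rewrite (le_trans _ (IH y))// iter_step_small_ge0.
Qed.

(* The two bounds isolate the paths with exactly one big jump; at least two
   big jumps contribute at most [(n p massB)^2 / 2]. *)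
Lemma iter_step_ge_one_jump n g : bounded_measurable g -> (forall x, 0 <= g x) ->
  forall x, n.+1%:R * p * iter n step_small (convol mB g) x <= iter n.+1 step g x.
Proof.
move=> bg g0; elim: n => [x|n IH x].
  rewrite /= mul1r /step lerDr.
  by have := @iter_step_small_ge0 1 _ bg g0 x.
have bB := convol_bmf mB bg.
have bQ := iter_step_small_bmf n bB; have bP := iter_step_bmf n.+1 bg.
have := step_small_le (bmfZ (n.+1%:R * p) bQ) bP IH x.
have -> : step_small (fun x => n.+1%:R * p * iter n step_small (convol mB g) x) x
    = n.+1%:R * p * iter n.+1 step_small (convol mB g) x.
  rewrite (_ : (fun x => _) = (fun x => 0 + n.+1%:R * p * iter n step_small (convol mB g) x)).
    by rewrite step_small_lin//; [rewrite step_small_cst mulr0 add0r|exact: bmf_cst].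
  by apply/funext => y; rewrite add0r.
have : convol mB (iter n.+1 step_small g) x <= convol mB (iter n.+1 step g) x.
  apply: convol_le => //; first exact: iter_step_small_bmf.
  exact: iter_step_ge_small.
rewrite -iter_step_small_convolC// => H1 H2.
rewrite [leRHS]/= /step -/(iter n.+1 step g).
have := ler_wpM2l p0 H1; move: H2.
set A := iter n.+1 step_small _ x.
rewrite -[n.+2]addn1 natrD; lra.
Qed.

Lemma iter_step_le_one_jump n g : bounded_measurable g -> (forall x, 0 <= g x <= 1) ->
  forall x, iter n.+1 step g x <= iter n.+1 step_small g x
    + n.+1%:R * p * iter n step_small (convol mB g) x
    + (n.+1%:R * p * massB) ^+ 2 / 2.
Proof.
move=> bg g01.
have g0 x : 0 <= g x by have /andP[] := g01 x.
have g1 x : g x <= 1 by have /andP[] := g01 x.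
have bB := convol_bmf mB bg.
elim: n => [x|n IH x].
  by rewrite /= mul1r /step lerDl divr_ge0// sqr_ge0.
have bQ := iter_step_small_bmf n bB; have bP := iter_step_bmf n.+1 bg.
have bS := iter_step_small_bmf n.+1 bg.
set c := _ ^+ 2 / 2 in IH.
pose k : R := n.+1%:R * p.
have bb : bounded_measurable (fun x => iter n.+1 step_small g x + k * iter n step_small (convol mB g) x).
  by apply: bmfD => //; exact: bmfZ.
have := step_le bP (bmfD bb (bmf_cst c)) IH x.
have -> : (fun x => iter n.+1 step_small g x + k * iter n step_small (convol mB g) x + c) =
   (fun x => iter n.+1 step_small g x + k * iter n step_small (convol mB g) x + 1 * c).
  by apply/funext => y; rewrite mul1r.
rewrite (step_lin 1 bb (bmf_cst c)) step_cst mul1r (step_lin _ bS bQ).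
have -> : step (iter n.+1 step_small g) x =
    iter n.+2 step_small g x + p * iter n.+1 step_small (convol mB g) x.
  by rewrite iter_step_small_convolC.
have -> : step (iter n step_small (convol mB g)) x =
    iter n.+1 step_small (convol mB g) x + p * convol mB (iter n step_small (convol mB g)) x.
  by [].
(* A second big jump at the new step adds at most [k * p * massB ^ 2], the cross term in the
   expansion of [((k + p) * massB) ^ 2 / 2]. *)
have /(_ x) : forall x, convol mB (iter n step_small (convol mB g)) x <= massB * massB.
  apply: convol_le_cst => //; apply: iter_step_small_le_cst => //.
  by move=> y; rewrite -[leRHS]mul1r; exact: convol_le_cst.
have k0 : 0 <= k by rewrite mulr_ge0.
have kp0 : 0 <= k * p by rewrite mulr_ge0.
move=> /(ler_wpM2l kp0).
rewrite [iter n.+2 step g]/= /c -/k -[iter n.+1 step g]/(step (iter n step g)).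
have -> : n.+2%:R * p = k + p by rewrite /k -[n.+2]addn1 natrD; ring.
set A := iter n.+1 _ _ x; set B := iter n.+2 _ _ x; set C := convol _ _ x.
set D := step (step _) x => H1 H2.
have : 0 <= (p * massB) ^+ 2 by exact: sqr_ge0.
nra.
Qed.

End RandomWalk.

Section RealIntegrable.
Context {R : realType} {d} {T : measurableType d} (m : {measure set T -> \bar R}).

Lemma integrable_EFinD (D : set T) (f g : T -> R) : measurable D ->
  m.-integrable D (EFin \o f) -> m.-integrable D (EFin \o g) ->
  m.-integrable D (EFin \o (fun y => f y + g y)).
Proof. by move=> mD i1 i2; exact: (integrableD mD i1 i2). Qed.

Lemma integrable_EFinZ (D : set T) c (f : T -> R) : measurable D ->
  m.-integrable D (EFin \o f) -> m.-integrable D (EFin \o (fun y => c * f y)).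
Proof. by move=> mD i1; exact: (integrableZl mD c i1). Qed.

End RealIntegrable.

(** * Second and exponential moments of the walk restricted to small jumps *)

Section Lyapunov.
Context {R : realType} (mS mB : {finite_measure set (measurableTypeR R) -> \bar R}).
Context (p eta : R) (p0 : 0 <= p)
  (pmass : p * (fine (mS setT) + fine (mB setT)) <= 1)
  (symS : symmetric_measure mS) (aeS : {ae mS, forall y, `|y| <= eta}).
Implicit Types (g h : R -> R) (n : nat).

Local Notation step_small := (step_small mS mB p).
Local Notation var := (\int[mS]_y y ^+ 2).

Let massB0 : 0 <= fine (mB setT). Proof. exact: fine_ge0. Qed.
Let pB0 : 0 <= p * fine (mB setT). Proof. exact: mulr_ge0. Qed.

Let le_convolS g h x : bounded_measurable g ->
  mS.-integrable setT (EFin \o (fun y => h (x + y))) ->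
  (forall y, g y <= h y) -> convol mS g x <= \int[mS]_y h (x + y).
Proof.
by move=> bg ih gh; apply: le_Rintegral => //; exact: bmf_integrable_shift.
Qed.

Let integrable_id : mS.-integrable setT (EFin \o id).
Proof. exact: (ae_bounded_integrable aeS (K := eta)). Qed.

Let integrable_sqr : mS.-integrable setT (EFin \o (fun y : R => y ^+ 2)).
Proof.
apply: (ae_bounded_integrable aeS (K := eta ^+ 2)); first exact: measurable_funX.
by move=> y yeta; rewrite normrX ler_pXn2r// nnegrE (le_trans _ yeta).
Qed.

Let integrable_cst (c : R) : mS.-integrable setT (EFin \o (fun=> c)).
Proof. exact: (bmf_integrable mS (X := id) (g := fun=> c)) (bmf_cst c). Qed.

Let var0 : 0 <= var.
Proof. by apply: Rintegral_ge0 => y _; exact: sqr_ge0. Qed.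

Let second_moment x :
  mS.-integrable setT (EFin \o (fun y : R => (x + y) ^+ 2)) /\
  \int[mS]_y (x + y) ^+ 2 = x ^+ 2 * fine (mS setT) + var.
Proof.
have i1 : mS.-integrable setT (EFin \o (fun y : R => 2 * x * y)).
  apply: (ae_bounded_integrable aeS (K := `|2 * x| * eta)); first exact: measurable_funM.
  by move=> y yeta; rewrite normrM ler_wpM2l.
have i2 : mS.-integrable setT (EFin \o (fun y : R => x ^+ 2 + 2 * x * y)).
  by apply: integrable_EFinD.
have -> : (fun y : R => (x + y) ^+ 2) = (fun y : R => x ^+ 2 + 2 * x * y + y ^+ 2).
  by apply/funext => y; ring.
split; first exact: integrable_EFinD.
rewrite RintegralD// RintegralD// Rintegral_cst// RintegralZl//.
by rewrite (Rintegral_odd symS integrable_id)// mulr0 addr0.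
Qed.

(** By symmetry the cross term of [(x + y) ^+ 2] integrates to zero, so a step raises the quadratic
    majorant only by the constant [K * p * var]; the mass lost to big jumps lowers it further. *)
Lemma step_small_quad g K A : 0 <= K -> 0 <= A -> bounded_measurable g ->
  (forall x, g x <= K * x ^+ 2 + A) ->
  forall x, step_small g x <= K * x ^+ 2 + (A + K * p * var).
Proof.
move=> K0 A0 bg gK x; rewrite /step_small.
have [i2 E2] := second_moment x.
have iK : mS.-integrable setT (EFin \o (fun y : R => K * (x + y) ^+ 2)).
  by apply: integrable_EFinZ.
have : convol mS g x <= \int[mS]_y (K * (x + y) ^+ 2 + A).
  by apply: (le_convolS (h := fun z => K * z ^+ 2 + A)) => //; exact: integrable_EFinD.
rewrite RintegralD// Rintegral_cst// RintegralZl// E2.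
move=> /(ler_wpM2l p0) H.
have c0 : 0 <= 1 - p * (fine (mS setT) + fine (mB setT)) by rewrite subr_ge0.
have := ler_wpM2l c0 (gK x).
have := mulr_ge0 pB0 A0; have := mulr_ge0 pB0 (mulr_ge0 K0 (sqr_ge0 x)).
move: H; move: (fine (mS setT)) (fine (mB setT)) var (convol _ _ _) => s b v c.
lra.
Qed.

Lemma iter_step_small_quad n g K A : 0 <= K -> 0 <= A -> bounded_measurable g ->
  (forall x, g x <= K * x ^+ 2 + A) ->
  forall x, iter n step_small g x <= K * x ^+ 2 + (A + n%:R * (K * p * var)).
Proof.
move=> K0 A0 bg gK; elim: n => [x|n IH x] /=; first by rewrite mul0r addr0.
have A'0 : 0 <= A + n%:R * (K * p * var) by rewrite addr_ge0// !mulr_ge0.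
have := step_small_quad K0 A'0 (iter_step_small_bmf mS mB p n bg) IH x.
have -> // : A + n.+1%:R * (K * p * var) = A + n%:R * (K * p * var) + K * p * var.
by rewrite -natr1; ring.
Qed.

(** By [coshD] and symmetry, the mean of [cosh (u * (x + y))] is [cosh (u * x)] times that of
    [cosh (u * y)], and [cosh_sub1_le] bounds the latter through the variance because [|y| <= eta]
    almost everywhere. *)
Lemma step_small_cosh g K u : 0 < eta -> 0 <= K -> 0 < u -> bounded_measurable g ->
  (forall x, g x <= K * cosh (u * x)) -> forall x, step_small g x <=
    K * (1 + p * (var / eta ^+ 2 * (cosh (u * eta) - 1))) * cosh (u * x).
Proof.
move=> eta0 K0 u0 bg gK x; rewrite /step_small.
have mu : measurable_fun (setT : set R) (fun y : R => u * y) by exact: measurable_funM.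
have bc (y : R) : `|y| <= eta -> `|u * y| <= u * eta.
  by move=> ye; rewrite normrM (gtr0_norm u0) ler_wpM2l// ltW.
have ic : mS.-integrable setT (EFin \o (fun y : R => cosh (u * y))).
  apply: (ae_bounded_integrable aeS (K := cosh (u * eta))).
    exact: (measurableT_comp measurable_cosh).
  move=> y /bc ye; rewrite gtr0_norm ?cosh_gt0//.
  by rewrite -[leLHS]cosh_norm ler_cosh.
have is_ : mS.-integrable setT (EFin \o (fun y : R => sinh (u * y))).
  apply: (ae_bounded_integrable aeS (K := cosh (u * eta))).
    exact: (measurableT_comp measurable_sinh).
  move=> y /bc ye; rewrite (@le_trans _ _ (cosh (u * y)))//.
    rewrite /cosh /sinh normrM (ger0_norm (x := 2^-1))// ler_pM2r//.
    by rewrite (le_trans (ler_normB _ _))// !ger0_norm ?expR_ge0.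
  by rewrite -[leLHS]cosh_norm ler_cosh.
have Ec : (fun y : R => K * cosh (u * (x + y))) =
    (fun y => K * cosh (u * x) * cosh (u * y) + K * sinh (u * x) * sinh (u * y)).
  by apply/funext => y; rewrite mulrDr coshD; ring.
have : convol mS g x <= \int[mS]_y (K * cosh (u * (x + y))).
  apply: (le_convolS (h := fun z => K * cosh (u * z))) => //.
  by rewrite Ec; apply: integrable_EFinD => //; apply: integrable_EFinZ.
rewrite Ec RintegralD//; last 2 first.
- by apply: integrable_EFinZ.
- by apply: integrable_EFinZ.
rewrite RintegralZl// RintegralZl// (Rintegral_odd symS is_)//; last first.
  by move=> y; rewrite mulrN sinhN.
rewrite mulr0 addr0 => H.
have : \int[mS]_y cosh (u * y) <=
    fine (mS setT) + var / eta ^+ 2 * (cosh (u * eta) - 1).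
  have ce0 : 0 <= (cosh (u * eta) - 1) / eta ^+ 2.
    by rewrite divr_ge0 ?sqr_ge0// cosh_half mulr_ge0// sqr_ge0.
  have -> : fine (mS setT) + var / eta ^+ 2 * (cosh (u * eta) - 1) =
      \int[mS]_y (1 + (cosh (u * eta) - 1) / eta ^+ 2 * y ^+ 2).
    rewrite RintegralD//; last by apply: integrable_EFinZ.
    by rewrite Rintegral_cst// RintegralZl//; ring.
  have ir : mS.-integrable setT (EFin \o (fun y : R => 1 + (cosh (u * eta) - 1) / eta ^+ 2 * y ^+ 2)).
    by apply: integrable_EFinD => //; apply: integrable_EFinZ.
  apply: fine_le; [exact: integrable_fin_num ic|exact: integrable_fin_num ir|].
  apply: ae_ge0_le_integral => //.
  - by move=> y _; rewrite lee_fin ltW// cosh_gt0.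
  - exact: measurable_int ic.
  - by move=> y _; rewrite lee_fin addr_ge0// mulr_ge0// sqr_ge0.
  - exact: measurable_int ir.
  move: aeS; apply: (@filterS _ _ (ae_filter_ringOfSetsType mS)) => y ye _.
  rewrite lee_fin -lerBlDl.
  rewrite (le_trans (cosh_sub1_le (bc y ye) _)) ?mulr_gt0//.
  by rewrite le_eqVlt; apply/orP; left; apply/eqP; field; rewrite !gt_eqF.
set w := var / _ * _ => Hw.
have Kc : 0 <= K * cosh (u * x) by rewrite mulr_ge0// ltW// cosh_gt0.
have {H Hw} := le_trans H (ler_wpM2l Kc Hw).
move=> /(ler_wpM2l p0).
have c0 : 0 <= 1 - p * (fine (mS setT) + fine (mB setT)) by rewrite subr_ge0.
have := ler_wpM2l c0 (gK x).
have := mulr_ge0 pB0 Kc.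
have -> : K * (1 + p * w) * cosh (u * x) = K * cosh (u * x) * (1 + p * w) by ring.
move: (K * cosh (u * x)) (fine (mS setT)) (fine (mB setT)) w (convol _ _ _) => k s b v c.
lra.
Qed.

Lemma iter_step_small_cosh n g K u : 0 < eta -> 0 <= K -> 0 < u -> bounded_measurable g ->
  (forall x, g x <= K * cosh (u * x)) -> forall x, iter n step_small g x <=
    K * expR (n%:R * p * (var / eta ^+ 2 * (cosh (u * eta) - 1))) * cosh (u * x).
Proof.
move=> eta0 K0 u0 bg gK.
set w := var / _ * _.
have w0 : 0 <= w.
  by rewrite mulr_ge0 ?divr_ge0 ?sqr_ge0// cosh_half mulr_ge0// sqr_ge0.
have H x : iter n step_small g x <= K * (1 + p * w) ^+ n * cosh (u * x).
  elim: n x => [|n IH] x /=; first by rewrite expr0 mulr1.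
  have K'0 : 0 <= K * (1 + p * w) ^+ n.
    by rewrite mulr_ge0// exprn_ge0// addr_ge0// mulr_ge0.
  have := step_small_cosh eta0 K'0 u0 (iter_step_small_bmf mS mB p n bg) IH x.
  by rewrite -/w exprSr (mulrA K).
move=> x; rewrite (le_trans (H x))// ler_wpM2r ?(ltW (cosh_gt0 _))//.
rewrite ler_wpM2l// -mulrA expRM_natl lerXn2r ?nnegrE ?expR_ge0//.
  by rewrite addr_ge0// mulr_ge0.
exact: expR_ge1Dx.
Qed.

End Lyapunov.

(** * Characteristic functions of the walks *)

Section Cosine.
Context {R : realType} (mS mB : {finite_measure set (measurableTypeR R) -> \bar R}).
Context (p : R) (symS : symmetric_measure mS) (symB : symmetric_measure mB).

Lemma convol_cos (m : {finite_measure set (measurableTypeR R) -> \bar R}) u x :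
  symmetric_measure m ->
  convol m (fun y => cos (u * y)) x = (\int[m]_y cos (u * y)) * cos (u * x).
Proof.
move=> sm; rewrite /convol.
have ic : m.-integrable setT (EFin \o (fun y : R => cos (u * y))).
  exact: (bmf_integrable m (X := id) (g := fun y => cos (u * y)) _ (bmf_cos u)).
have is_ : m.-integrable setT (EFin \o (fun y : R => sin (u * y))).
  apply: (bmf_integrable m (X := id) (g := fun y => sin (u * y))) => //; split.
    apply: measurableT_comp; last exact: measurable_funM.
    by apply: continuous_measurable_fun; exact: continuous_sin.
  by exists 1 => y; rewrite ler_norml sin_geN1 sin_le1.
under eq_Rintegral do rewrite mulrDr cosD.
rewrite RintegralB//; last 2 first.
- by apply: integrable_EFinZ.
- by apply: integrable_EFinZ.
rewrite RintegralZl// RintegralZl// (Rintegral_odd sm is_).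
  by rewrite mulr0 subr0 mulrC.
by move=> y; rewrite mulrN sinN.
Qed.

(** Against symmetric measures the sine part of [cos (u * (x + y))] vanishes, so the cosine is an
    eigenfunction of [step], and the iterate is a power of the eigenvalue. *)
Lemma iter_step_cos n u x :
  iter n (step mS mB p) (fun y => cos (u * y)) x =
  (1 - p * (\int[mS]_y (1 - cos (u * y)) + \int[mB]_y (1 - cos (u * y)))) ^+ n
  * cos (u * x).
Proof.
have E (m : {finite_measure set (measurableTypeR R) -> \bar R}) :
    \int[m]_y (1 - cos (u * y)) = fine (m setT) - \int[m]_y cos (u * y).
  rewrite RintegralB//; first by rewrite Rintegral_cst// mul1r.
    exact: (bmf_integrable m (X := id) (g := fun y => 1) _ (bmf_cst 1)).
  exact: (bmf_integrable m (X := id) (g := fun y => cos (u * y)) _ (bmf_cos u)).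
rewrite !E; set c := 1 - _.
suff -> : iter n (step mS mB p) (fun y => cos (u * y)) = (fun x => c ^+ n * cos (u * x)).
  by [].
elim: n => [|n IH] /=; first by apply/funext => y; rewrite expr0 mul1r.
rewrite IH; apply/funext => y; rewrite /step /step_small !convolZ ?convol_cos//;
  try exact: bmf_cos.
by rewrite /c exprS; ring.
Qed.

End Cosine.

(** * A polynomial close to a step function on the unit interval *)

Section StepPolynomial.
Context {R : realType}.

Lemma bernoulli_ineq (x : R) n : 0 <= x <= 1 -> 1 - n%:R * x <= (1 - x) ^+ n.
Proof.
move=> /andP[x0 x1]; elim: n => [|n IH]; first by rewrite mul0r subr0 expr0.
have : (1 - n%:R * x) * (1 - x) <= (1 - x) ^+ n.+1.
  by rewrite exprSr ler_wpM2r// subr_ge0.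
have : 0 <= n%:R * x * x by rewrite !mulr_ge0.
by rewrite -natr1; lra.
Qed.

(** From [n x <= (1 + x) ^ n] and [(1 - x ^ 2) ^ n <= 1]. It makes [(1 - x) ^ n] small when [n x] is
    large, while [bernoulli_ineq] keeps it near 1 when [n x] is small. *)
Lemma exp_onem_le (x : R) n : 0 <= x <= 1 -> (1 - x) ^+ n * (n%:R * x) <= 1.
Proof.
move=> /andP[x0 x1].
have H : n%:R * x <= (1 + x) ^+ n.
  elim: n => [|n IH]; first by rewrite mul0r expr0.
  rewrite exprSr mulrDr mulr1 -natr1 mulrDl mul1r lerD//.
  by rewrite -[leLHS]mul1r ler_wpM2r// exprn_ege1// lerDl.
rewrite (@le_trans _ _ ((1 - x) ^+ n * (1 + x) ^+ n))//.
  by rewrite ler_wpM2l// exprn_ge0// subr_ge0.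
rewrite -exprMn exprn_ile1//; first by rewrite mulr_ge0 ?subr_ge0// addr_ge0.
by have := sqr_ge0 x; rewrite expr2; lra.
Qed.

(* [(1 - q ^ m) ^ N] with [N ~ r ^ (- m)], [q1 < r < q2], falls from almost 1 to
   almost 0 between [q1] and [q2]. *)
Lemma step_polynomial (q1 q2 kappa : R) : 0 <= q1 < q2 -> q2 <= 1 -> 0 < kappa ->
  exists m N : nat,
    (forall q, 0 <= q <= q1 -> 1 - kappa <= (1 - q ^+ m) ^+ N) /\
    (forall q, q2 <= q <= 1 -> (1 - q ^+ m) ^+ N <= kappa).
Proof.
move=> /andP[q10 q12] q21 k0.
pose r := (q1 + q2) / 2.
have q1r : q1 < r by rewrite /r; lra.
have rq2 : r < q2 by rewrite /r; lra.
clearbody r; have r0 : 0 < r by lra.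
have r1 : r <= 1 by lra.
have q20 : 0 < q2 by lra.
have norm_lt1 (a b : R) : 0 <= a -> a < b -> `|a / b| < 1.
  move=> a0 ab; have b0 : 0 < b by lra.
  by rewrite ger0_norm ?divr_ge0 ?(ltW b0)// ltr_pdivrMr// mul1r.
have k20 : 0 < kappa / 2 by rewrite divr_gt0.
have c1 : \forall m \near \oo, (q1 / r) ^+ m < kappa / 2.
  by apply: (@cvgr_lt _ _ _ _ _ 0) => //; exact: cvg_expr (norm_lt1 _ _ q10 q1r).
have c2 : \forall m \near \oo, (r / q2) ^+ m < kappa.
  by apply: (@cvgr_lt _ _ _ _ _ 0) => //; exact: cvg_expr (norm_lt1 _ _ (ltW r0) rq2).
have [m _ /(_ m (leqnn m))[/= H1 H2]] := filterI c1 c2.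
have rm0 : 0 < r ^+ m by rewrite exprn_gt0.
have rm1 : 1 <= (r ^+ m)^-1 by rewrite invf_ge1// exprn_ile1// ltW.
have /andP[N1 N2] := truncn_itv (le_trans ler01 rm1).
set N := (Num.trunc _).+1 in N2.
have {}N1 : N%:R <= 2 * (r ^+ m)^-1.
  by rewrite /N -natr1; lra.
have e1 (q : R) : 0 <= q -> q <= 1 -> 0 <= q ^+ m <= 1.
  by move=> q0 qq1; rewrite exprn_ge0//= exprn_ile1.
exists m, N; split=> q /andP[qa qb].
  have q1' : q <= 1 by lra.
  rewrite (le_trans _ (bernoulli_ineq N (e1 q qa q1')))// lerB//.
  rewrite (@le_trans _ _ (2 * (r ^+ m)^-1 * q1 ^+ m))//.
    by rewrite ler_pM// ?exprn_ge0// lerXn2r.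
  by move: H1; rewrite expr_div_n; lra.
have q0 : 0 <= q by lra.
have := exp_onem_le N (e1 q q0 qb).
set z := (1 - _) ^+ _ => Hz.
have z0 : 0 <= z.
  by rewrite exprn_ge0// subr_ge0; have /andP[] := e1 q q0 qb.
have : z * ((r ^+ m)^-1 * q2 ^+ m) <= 1.
  rewrite (le_trans _ Hz)// ler_wpM2l// ler_pM ?exprn_ge0 ?(ltW q20)//.
  - by rewrite ltW// (lt_le_trans _ rm1).
  - exact: ltW.
  - by rewrite lerXn2r// nnegrE ltW.
have -> : (r ^+ m)^-1 * q2 ^+ m = ((r / q2) ^+ m)^-1.
  by rewrite expr_div_n invf_div mulrC.
have rq0 : 0 < (r / q2) ^+ m by rewrite exprn_gt0// divr_gt0.
by rewrite ler_pdivrMr// mul1r => /le_trans; apply; exact: ltW.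
Qed.

End StepPolynomial.

(** * Transfer from approximating functionals to a probability *)

Lemma measurable_norm_gt {R : realType} (a : R) : measurable [set x : R | a < `|x|].
Proof.
have -> : [set x : R | a < `|x|] = (@Num.norm R R) @^-1` `]a, +oo[.
  by apply/seteqP; split => x /=; rewrite in_itv/= andbT.
by rewrite -[X in measurable X]setTI; exact: normr_measurable.
Qed.

Lemma measurable_norm_itv {R : realType} (b c : R) :
  measurable [set x : R | b <= `|x| <= c].
Proof.
have -> : [set x : R | b <= `|x| <= c] = (@Num.norm R R) @^-1` `[b, c].
  by apply/seteqP; split => x /=; rewrite in_itv.
by rewrite -[X in measurable X]setTI; exact: normr_measurable.
Qed.

Section Transfer.
Context {R : realType} {d} {T : measurableType d} (P : probability T R).
Context (Y : {RV P >-> R}) (L : nat -> (R -> R) -> R).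
Context (L_lin : forall k a g h, bounded_measurable g -> bounded_measurable h ->
    L k (fun x => g x + a * h x) = L k g + a * L k h)
  (L_le : forall k g h, bounded_measurable g -> bounded_measurable h ->
    (forall x, g x <= h x) -> L k g <= L k h)
  (L_cst : forall k c, L k (fun=> c) = c)
  (L_cos : forall u,
    L k (fun x => cos (u * x)) @[k --> \oo] --> \int[P]_w cos (u * Y w)).
Implicit Types g h : R -> R.

Let mY : measurable_fun setT Y. Proof. exact: measurable_funP. Qed.

Let integrableY g : bounded_measurable g -> P.-integrable setT (EFin \o (g \o Y)).
Proof. exact: bmf_integrable. Qed.

(* The factor [cos (u * x)] makes this class stable under multiplication by
   cosines, hence by trigonometric polynomials. *)
Definition cos_limit h : Prop := bounded_measurable h /\
  forall u, L k (fun x => h x * cos (u * x)) @[k --> \oo] -->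
    \int[P]_w (h (Y w) * cos (u * Y w)).

Let cos_limit_ext g h : (forall x, g x = h x) -> cos_limit g -> cos_limit h.
Proof. by move=> /funext ->. Qed.

Let cos_limit1 : cos_limit (fun=> 1).
Proof.
split=> [|u]; first exact: bmf_cst.
under eq_Rintegral do rewrite mul1r.
have -> : (fun x : R => 1 * cos (u * x)) = (fun x => cos (u * x)).
  by apply/funext => x; rewrite mul1r.
exact: L_cos.
Qed.

Let cos_limit_lin a g h : cos_limit g -> cos_limit h ->
  cos_limit (fun x => g x + a * h x).
Proof.
move=> [bg cg] [bh ch]; split=> [|u]; first by apply: bmfD => //; exact: bmfZ.
have bgc : bounded_measurable (fun x => g x * cos (u * x)).
  by apply: bmfM => //; exact: bmf_cos.
have bhc : bounded_measurable (fun x => h x * cos (u * x)).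
  by apply: bmfM => //; exact: bmf_cos.
have E : (fun x => (g x + a * h x) * cos (u * x)) =
    (fun x => g x * cos (u * x) + a * (h x * cos (u * x))).
  by apply/funext => x; ring.
rewrite (_ : (fun k => L k _) =
    (fun k => L k (fun x => g x * cos (u * x)) + a * L k (fun x => h x * cos (u * x)))); last first.
  by apply/funext => k; rewrite E L_lin.
under eq_Rintegral do rewrite mulrDl -mulrA.
rewrite RintegralD//; last 2 first.
- exact: (integrableY bgc).
- exact: (integrableY (bmfZ a bhc)).
rewrite RintegralZl//; last exact: (integrableY bhc).
by apply: cvgD => //; apply: cvgMr.
Qed.

(** The product-to-sum formula turns the two cosines into frequencies [theta + u] and [theta - u],
    both covered by the assumption on [h]. *)
Let cos_limit_cos theta h : cos_limit h -> cos_limit (fun x => h x * cos (theta * x)).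
Proof.
move=> [bh ch]; split=> [|u]; first by apply: bmfM => //; exact: bmf_cos.
have bhc v : bounded_measurable (fun x => h x * cos (v * x)).
  by apply: bmfM => //; exact: bmf_cos.
have E x : h x * cos (theta * x) * cos (u * x) =
    2^-1 * (h x * cos ((theta + u) * x)) + 2^-1 * (h x * cos ((theta - u) * x)).
  by rewrite !mulrDl mulNr cosD cosB; field.
rewrite (_ : (fun k => L k _) =
    (fun k => 2^-1 * L k (fun x => h x * cos ((theta + u) * x)) +
              2^-1 * L k (fun x => h x * cos ((theta - u) * x)))); last first.
  apply/funext => k; rewrite -[in RHS](add0r (2^-1 * L k _)) -[in RHS](L_cst k 0).
  rewrite -L_lin//; last exact: bmf_cst.
  rewrite -L_lin//; last by apply: bmfD; [exact: bmf_cst|exact: bmfZ].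
  by congr (L k _); apply/funext => x; rewrite E add0r.
under eq_Rintegral do rewrite E.
rewrite RintegralD//; last 2 first.
- exact: (integrableY (bmfZ _ (bhc _))).
- exact: (integrableY (bmfZ _ (bhc _))).
rewrite !RintegralZl//; try exact: (integrableY (bhc _)).
by apply: cvgD; apply: cvgMr.
Qed.

Let q theta (x : R) : R := (1 + cos (theta * x)) / 2.

Let cos_limit_q theta h : cos_limit h -> cos_limit (fun x => h x * q theta x).
Proof.
move=> ch; have ch0 : cos_limit (fun x => 0).
  have := cos_limit_lin (-1) cos_limit1 cos_limit1.
  by apply: cos_limit_ext => x; rewrite mulN1r subrr.
have := cos_limit_lin 2^-1 (cos_limit_lin 2^-1 ch0 ch) (cos_limit_cos theta ch).
by apply: cos_limit_ext => x; rewrite /q; field.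
Qed.

Let cos_limit_step theta m N : cos_limit (fun x => (1 - q theta x ^+ m) ^+ N).
Proof.
elim: N => [|N IH].
  by apply: cos_limit_ext cos_limit1 => x; rewrite expr0.
have cm h j : cos_limit h -> cos_limit (fun x => h x * q theta x ^+ j).
  move=> ch; elim: j => [|j IHj]; first by apply: cos_limit_ext ch => x; rewrite expr0 mulr1.
  have := cos_limit_q theta IHj.
  by apply: cos_limit_ext => x; rewrite exprSr mulrA.
have := cos_limit_lin (-1) IH (cm _ m IH).
by apply: cos_limit_ext => x; rewrite exprSr; ring.
Qed.

(** The step polynomial is composed with [q theta x = (1 + cos (theta * x)) / 2], which takes values
    in the unit interval. Beyond [c] periodicity takes over and only [0 <= h x <= 1] is kept. *)
Lemma trig_step (a b c kappa : R) : 0 <= a < b -> b <= c -> 0 < kappa ->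
  exists h, [/\ bounded_measurable h,
    L k h @[k --> \oo] --> \int[P]_w h (Y w),
    forall x, 0 <= h x <= 1,
    forall x, `|x| <= a -> h x <= kappa &
    forall x, b <= `|x| <= c -> 1 - kappa <= h x].
Proof.
move=> /andP[a0 ab] bc k0.
have c0 : 0 < c by lra.
(* Half a period equals [c], so that [q theta] decreases in [|x|] up to [c]. *)
pose theta := pi / c.
have th0 : 0 < theta by rewrite divr_gt0 ?pi_gt0.
have thc : theta * c = pi by rewrite /theta divfK// gt_eqF.
have mem x : 0 <= x -> x <= c -> theta * x \in `[0, pi].
  by move=> x0 xc; rewrite in_itv/= mulr_ge0 ?(ltW th0)//= -thc ler_pM2l.
have cos_lt x y : 0 <= x -> x < y -> y <= c -> cos (theta * y) < cos (theta * x).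
  by move=> x0 xy yc; rewrite ltr_cos ?mem ?ltr_pM2l//; lra.
have cos_le x y : 0 <= x -> x <= y -> y <= c -> cos (theta * y) <= cos (theta * x).
  move=> x0; rewrite le_eqVlt => /predU1P[->//|xy] yc.
  by rewrite ltW// cos_lt.
have qE x : q theta x = q theta `|x|.
  by rewrite /q -[in RHS](gtr0_norm th0) -normrM cos_norm.
have q01 x : 0 <= q theta x <= 1.
  by rewrite /q; have := cos_geN1 (theta * x); have := cos_le1 (theta * x); lra.
have q12 : q theta b < q theta a.
  by have := cos_lt _ _ a0 ab bc; rewrite /q; lra.
have /andP[qb0 _] := q01 b; have /andP[_ qa1] := q01 a.
have [|m [N [H1 H2]]] := @step_polynomial R (q theta b) (q theta a) kappa _ qa1 k0.
  by rewrite qb0.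
have [bh ch] := cos_limit_step theta m N.
exists (fun x => (1 - q theta x ^+ m) ^+ N); split=> //.
- have := ch 0.
  rewrite (_ : (fun x => _ * cos (0 * x)) = (fun x => (1 - q theta x ^+ m) ^+ N)); last first.
    by apply/funext => x; rewrite mul0r cos0 mulr1.
  by under eq_Rintegral do rewrite mul0r cos0 mulr1.
- move=> x; have /andP[q0 q1] := q01 x.
  have qm1 : q theta x ^+ m <= 1 by rewrite exprn_ile1.
  by rewrite exprn_ge0 ?subr_ge0//= exprn_ile1 ?subr_ge0// gerBl exprn_ge0.
- move=> x xa; apply: H2; have /andP[_ ->] := q01 x; rewrite andbT (qE x).
  have aC : a <= c by lra.
  by have := cos_le `|x| a (normr_ge0 x) xa aC; rewrite /q; lra.
- move=> x /andP[bx xc]; apply: H1; have /andP[-> _] := q01 x; rewrite /= (qE x).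
  by have := cos_le b `|x| (ltW (le_lt_trans a0 ab)) bx xc; rewrite /q; lra.
Qed.

Let le_expectation g h : bounded_measurable g -> bounded_measurable h ->
  (forall x, g x <= h x) -> \int[P]_w g (Y w) <= \int[P]_w h (Y w).
Proof. by move=> bg bh gh; apply: le_Rintegral => //; exact: integrableY. Qed.

Let expectation_indic (D : set R) : measurable D ->
  \int[P]_w (\1_D (Y w)) = fine (P (Y @^-1` D)).
Proof.
move=> mD; rewrite /Rintegral; congr fine.
have mYD : measurable (Y @^-1` D).
  by rewrite -[X in measurable X]setTI; exact: mY.
by have := integral_indic P measurableT mYD; rewrite setIT.
Qed.

Let le_expectationD g h c : bounded_measurable g -> bounded_measurable h ->
  (forall x, g x <= h x + c) -> \int[P]_w g (Y w) <= \int[P]_w h (Y w) + c.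
Proof.
move=> bg bh gh; have bc := bmf_cst c.
apply: (le_trans (le_expectation bg (bmfD bh bc) gh)).
rewrite (RintegralD measurableT (integrableY bh) (integrableY bc)).
have /= := Rintegral_cst P measurableT c => ->.
have -> : P setT = 1%E by exact: probability_setT.
by rewrite mulr1.
Qed.

(** As [g] lives on the shell, [g - e / 2 <= h] holds on the whole line; on the side of [Y], [h] is
    at most the indicator of [a < |x|] plus [e / 2]. *)
Lemma limit_prob_ge (a b c V : R) g : 0 <= a < b -> b <= c ->
  bounded_measurable g -> (forall x, 0 <= g x <= (b <= `|x| <= c)%R%:R) ->
  (forall k, V <= L k g) -> V <= fine (P [set w | a < `|Y w|]).
Proof.
move=> ab bc bg g01 VL; apply/ler_addgt0Pr => e e0.
have e20 : 0 < e / 2 by rewrite divr_gt0.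
have [h [bh hlim h01 ha hbc]] := trig_step ab bc e20.
have V1 : V <= 1.
  rewrite (le_trans (VL 0%N))// -(L_cst 0 1); apply: L_le => //; first exact: bmf_cst.
  by move=> x; have /andP[_] := g01 x; case: (_ && _) => //= /le_trans; apply.
have mA := measurable_norm_gt a.
have bA := bmf_indic mA.
have : \int[P]_w h (Y w) <= fine (P [set w | a < `|Y w|]) + e / 2.
  rewrite -(expectation_indic mA); apply: le_expectationD => // x.
  have /andP[_ hx1] := h01 x.
  rewrite indicE; case: (boolP (x \in _)) => [|/negP].
    by move=> _ /=; lra.
  rewrite inE /= => /negP; rewrite -leNgt => /ha; rewrite add0r.
  exact.
have : V - e / 2 <= \int[P]_w h (Y w).
  apply: (cvgr_to_ge hlim); apply: nearW => k.
  have bc' := bmf_cst (- (e / 2)).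
  apply: (@le_trans _ _ (L k (fun x => - (e / 2) + 1 * g x))).
    by rewrite L_lin// L_cst; have := VL k; lra.
  apply: L_le => //; first by apply: bmfD => //; exact: bmfZ.
  move=> x; have /andP[gx0 gx1] := g01 x; have /andP[hx0 hx1] := h01 x.
  case: (boolP (b <= `|x| <= c)) gx1 => [/hbc|_] /=; lra.
lra.
Qed.

(** Here [h] is at most the indicator of [a < |x|] plus [e / 2] everywhere, so the walks need no
    truncation. The comparison of [h] with an indicator from above works only on shells, which are
    then exhausted by continuity from below. *)
Lemma limit_prob_le (a U : R) : 0 <= a ->
  (forall k, L k \1_[set x | a < `|x|] <= U) ->
  fine (P [set w | a < `|Y w|]) <= U.
Proof.
move=> a0 LU.
have mA := measurable_norm_gt a.
have bA := bmf_indic mA.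
have shell b c : a < b -> b <= c -> fine (P (Y @^-1` [set x | b <= `|x| <= c])) <= U.
  move=> ab bc; apply/ler_addgt0Pr => e e0.
  have e20 : 0 < e / 2 by rewrite divr_gt0.
  have a0b : 0 <= a < b by rewrite a0.
  have [h [bh hlim h01 ha hbc]] := trig_step a0b bc e20.
  have mS := measurable_norm_itv b c; have bS := bmf_indic mS.
  have : \int[P]_w h (Y w) <= U + e / 2.
    apply: (cvgr_to_le hlim); apply: nearW => k.
    apply: (@le_trans _ _ (L k (fun x => e / 2 + 1 * \1_[set x | a < `|x|] x))).
      apply: L_le => //; first by apply: bmfD (bmf_cst _) (bmfZ _ bA).
      move=> x; have /andP[hx0 hx1] := h01 x.
      rewrite indicE; case: (boolP (x \in _)) => [|/negP].
        by move=> _ /=; lra.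
      by rewrite inE /= => /negP; rewrite -leNgt => /ha; rewrite mulr0 addr0.
    by rewrite L_lin ?L_cst//; [have := LU k; lra|exact: bmf_cst].
  have : fine (P (Y @^-1` [set x | b <= `|x| <= c])) <= \int[P]_w h (Y w) + e / 2.
    rewrite -(expectation_indic mS); apply: le_expectationD => // x.
    have /andP[hx0 hx1] := h01 x.
    rewrite indicE; case: (boolP (x \in _)) => [|_ /=]; last lra.
    by rewrite inE /= => /hbc; lra.
  lra.
(* The extra 1 in the outer radius keeps it above the inner one already for [n = 0]. *)
pose F n := Y @^-1` [set x | a + n.+1%:R^-1 <= `|x| <= a + 1 + n%:R].
have mF n : measurable (F n).
  by rewrite -[X in measurable X]setTI; apply: mY => //; exact: measurable_norm_itv.
have FE : [set w | a < `|Y w|] = \bigcup_n F n.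
  apply/seteqP; split => [w /= aw|w [n _ /= /andP[/lt_le_trans + _]]]; last first.
    by apply; rewrite ltrDl invr_gt0.
  have aw0 : 0 < `|Y w| - a by rewrite subr_gt0.
  have y0 : 0 <= (`|Y w| - a)^-1 by rewrite invr_ge0 ltW.
  have /andP[_ n1] := truncn_itv y0.
  have /andP[_ n2] := truncn_itv (normr_ge0 (Y w)).
  set n := Num.trunc _ in n1; set n' := Num.trunc _ in n2.
  exists (n + n')%N => //=; apply/andP; split.
    rewrite -lerBrDl -[leRHS]invrK lef_pV2 ?posrE ?invr_gt0//.
    by rewrite (le_trans (ltW n1))// ler_nat ltnS leq_addr.
  rewrite (le_trans (ltW n2))// -natr1 natrD.
  have : 0 <= n%:R :> R by [].
  lra.
rewrite FE.
have mU : measurable (\bigcup_n F n) by exact: bigcup_measurable.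
have ndF : nondecreasing_seq F.
  apply/nondecreasing_seqP => n; apply/subsetPset => w /= /andP[h1 h2].
  apply/andP; split.
    by rewrite (le_trans _ h1)// lerD2l lef_pV2 ?posrE// ler_nat.
  by rewrite (le_trans h2)// lerD2l ler_nat.
have Pfin A : measurable A -> P A \is a fin_num by exact: fin_num_measure.
rewrite -lee_fin fineK ?Pfin//.
apply: (cvge_to_le (nondecreasing_cvg_mu mF mU ndF)).
apply: nearW => n /=; rewrite -[P (F n)]fineK ?Pfin// lee_fin.
apply: shell; first by rewrite ltrDl invr_gt0.
rewrite -addrA lerD2l (@le_trans _ _ 1)//; last by rewrite lerDl.
by rewrite invf_le1// ler1n.
Qed.

End Transfer.

(** * Levy measures with a density *)

Section Density.
Context {R : realType}.
Local Notation mu := (@lebesgue_measure R).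

Lemma integral_powR_deriv (c a b : R) : c != 0 -> 0 < a -> a < b ->
  (\int[mu]_(x in `[a, b]) (x `^ (c - 1))%:E = ((b `^ c - a `^ c) / c)%:E)%E.
Proof.
move=> c0 a0 ab.
have dF (x : R) : 0 < x -> is_derive x (1 : R) (fun y => c^-1 * y `^ c) (x `^ (c - 1)).
  move=> x0; have dx := is_derive1_powR c x0.
  apply: is_derive_eq.
  by rewrite /GRing.scale /= mulrA mulVf// mul1r.
have cF (x : R) : 0 < x -> {for x, continuous (fun y => c^-1 * y `^ c)}.
  move=> x0; apply: differentiable_continuous; apply/derivable1_diffP.
  exact: (@ex_derive _ _ _ _ _ _ _ (dF x x0)).
have cf (x : R) : 0 < x -> {for x, continuous (fun y => y `^ (c - 1))}.
  move=> x0; apply: differentiable_continuous; apply/derivable1_diffP.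
  exact: (@ex_derive _ _ _ _ _ _ _ (is_derive1_powR (c - 1) x0)).
rewrite (@continuous_FTC2 _ (fun y => y `^ (c - 1)) (fun y => c^-1 * y `^ c))//.
- by rewrite -EFinB -mulrBr mulrC.
- apply: continuous_in_subspaceT => x; rewrite inE/= in_itv/= => /andP[ax _].
  by apply: cf; rewrite (lt_le_trans a0).
- split.
  + move=> x; rewrite in_itv/= => /andP[ax _].
    exact: (@ex_derive _ _ _ _ _ _ _ (dF x (lt_trans a0 ax))).
  + by apply: cvg_at_right_filter; exact: cF.
  + by apply: cvg_at_left_filter; apply: cF; rewrite (lt_trans a0).
- move=> x; rewrite in_itv/= => /andP[ax _].
  by rewrite derive1E; exact: (@derive_val _ _ _ _ _ _ _ (dF x (lt_trans a0 ax))).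
Qed.

(** The Radon-Nikodym derivative of [m] has the same integrals as [f] over all measurable sets,
    hence equals [f] almost everywhere, and the change of variables for it carries over to [f]. *)
Lemma ge0_integral_density (m : {finite_measure set (measurableTypeR R) -> \bar R})
    (f : R -> R) (g : R -> \bar R) (E : set R) :
  has_density m f -> measurable E -> measurable_fun setT g -> (forall x, 0 <= g x)%E ->
  (\int[m]_(x in E) g x = \int[mu]_(x in E) (g x * (f x)%:E))%E.
Proof.
move=> [mf f0 mE_f] mE mg g0.
have mfE : measurable_fun setT (EFin \o f) by exact/measurable_EFinP.
have dom : m `<< mu.
  apply/null_content_dominatesP => A mA A0; rewrite mE_f//.
  by apply: null_set_integral => //; exact: measurable_funTS.
rewrite -(Radon_Nikodym_SigmaFinite.change_of_variables dom)//; last exact: measurable_funTS.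
apply: ae_eq_integral => //.
- apply: emeasurable_funM; first exact: measurable_funTS.
  apply: measurable_funTS.
  exact: measurable_int (Radon_Nikodym_SigmaFinite.f_integrable dom).
- by apply: emeasurable_funM; exact: measurable_funTS.
- have : ae_eq mu setT (Radon_Nikodym_SigmaFinite.f m mu) (EFin \o f).
    apply: integral_ae_eq => //.
      exact: (Radon_Nikodym_SigmaFinite.f_integrable dom).
    move=> A _ mA; rewrite -mE_f//.
    by rewrite -(Radon_Nikodym_SigmaFinite.f_integral dom).
  by apply: filterS => x /(_ I) -> _.
Qed.

End Density.

(** * Finite restrictions of a Lévy measure *)

Section Restriction.
Context {R : realType} (nu : {measure set (measurableTypeR R) -> \bar R}).

Lemma ge0_integral_mfrestr (D : set (measurableTypeR R)) (mD : measurable D)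
    (Doo : (nu D < +oo)%E) (g : R -> \bar R) :
  measurable_fun setT g -> (forall x, 0 <= g x)%E ->
  (\int[mfrestr mD Doo]_x g x = \int[nu]_(x in D) g x)%E.
Proof.
move=> mg g0.
have mDC : measurable (~` D) by exact: measurableC.
rewrite -(setUv D) ge0_integral_setU//; last 2 first.
- exact: measurable_funTS.
- by apply/disj_setPS; rewrite setICr.
rewrite [X in (_ + X)%E](_ : _ = 0%E) ?adde0.
  apply: eq_measure_integral => A mA AD.
  by rewrite /mfrestr /mrestr; congr (nu _); exact: setIidl.
apply: null_set_integral => //; first exact: measurable_funTS.
by transitivity (nu (~` D `&` D)); [|rewrite setICl measure0].
Qed.

Lemma mfrestr_symmetric (D : set (measurableTypeR R)) (mD : measurable D)
    (Doo : (nu D < +oo)%E) :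
  symmetric_measure nu -> (forall x, D x -> D (- (x : R))) ->
  symmetric_measure (mfrestr mD Doo).
Proof.
move=> snu sD A mA; rewrite /mfrestr /mrestr -[RHS]snu; last exact: measurableI.
congr (nu _); apply/seteqP; split => [_ [[x Ax <-] Dx]|_ [x [Ax Dx] <-]].
  by exists x => //; split => //; rewrite -[x]opprK; exact: sD.
by split; [exists x|exact: sD].
Qed.

Lemma mfrestr_density f (D : set (measurableTypeR R)) (mD : measurable D)
    (Doo : (nu D < +oo)%E) :
  has_density nu f -> has_density (mfrestr mD Doo) (f \_ D).
Proof.
move=> [mf f0 nuf]; split.
- by apply/(measurable_restrictT _ mD); exact: measurable_funTS.
- by move=> x; rewrite /patch; case: ifP.
- move=> A mA; transitivity (nu (A `&` D)); first by [].
  rewrite nuf; last exact: measurableI.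
  by rewrite integral_mkcondr; apply: eq_integral => x _; rewrite restrict_EFin.
Qed.

(** Markov's inequality: on the tail, [min (y ^ 2, 1)] is at least the positive constant
    [min (d ^ 2, 1)]. *)
Lemma levy_tail_fin (d : R) : 0 < d -> levy_measure nu ->
  (nu [set x | (d < `|x|)%R] < +oo)%E.
Proof.
move=> d0 [_ fin].
have mD := measurable_norm_gt d.
have mmin : measurable_fun (setT : set R) (fun y : R => (Num.min (y ^+ 2) 1)%:E).
  by apply/measurable_EFinP; apply: measurable_minr => //; exact: measurable_funX.
have min0 y : (0 <= (Num.min (y ^+ 2) (1 : R))%:E)%E.
  by rewrite lee_fin le_min sqr_ge0 ler01.
pose c := Num.min (d ^+ 2) 1.
have c0 : 0 < c by rewrite /c lt_min exprn_gt0// ltr01.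
have : (c%:E * nu [set x | (d < `|x|)%R] <= \int[nu]_y (Num.min (y ^+ 2) 1)%:E)%E.
  rewrite -integral_cst//.
  apply: (@le_trans _ _ (\int[nu]_(y in [set x | (d < `|x|)%R]) (Num.min (y ^+ 2) 1)%:E)%E).
    apply: ge0_le_integral => //.
    - by move=> y _; rewrite lee_fin ltW.
    - exact: measurable_funTS.
    - move=> y /= dy; rewrite lee_fin /c le_min ge_min [X in X || _](_ : _ = true) ?ge_min ?lexx ?orbT//.
      by rewrite -(real_normK (num_real y)) lerXn2r// ?nnegrE ?(ltW d0)// ltW.
  by apply: ge0_subset_integral.
move=> /le_lt_trans /(_ fin).
by rewrite muleC -lte_pdivlMr// => /lt_le_trans; apply; rewrite leey.
Qed.

End Restriction.

(** * Mass and variance of the jumps in a shell *)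

Section ShellBounds.
Context {R : realType} (nu : {measure set (measurableTypeR R) -> \bar R}).
Context (f : R -> R) (M alpha : R).
Context (nu_levy : levy_measure nu) (nu_sym : symmetric_measure nu)
  (nu_f : has_density nu f) (M0 : 0 < M) (f_L : class_L M alpha f)
  (alpha0 : 0 < alpha) (alpha2 : alpha < 2).
Local Notation mu := (@lebesgue_measure R).

Definition shell (d e : R) : set R := [set y | d < `|y| <= e].

Lemma measurable_shell d e : measurable (shell d e).
Proof.
have -> : shell d e = [set y | d < `|y|] `&` [set y | 0 <= `|y| <= e].
  by apply/seteqP; split => y; rewrite /shell/= normr_ge0/= => /andP.
by apply: measurableI; [exact: measurable_norm_gt|exact: measurable_norm_itv].
Qed.

Lemma shell_fin d e : 0 < d -> (nu (shell d e) < +oo)%E.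
Proof.
move=> d0; apply: le_lt_trans (levy_tail_fin d0 nu_levy).
apply: le_measure; rewrite ?inE; [exact: measurable_shell|exact: measurable_norm_gt|].
by move=> y /andP[].
Qed.

(** One computation for two weights: [w = 1] with [c = - alpha] gives the mass, [w = y ^+ 2] with
    [c = 2 - alpha] the variance. The bound [e <= 2] is the range on which [class_L] controls the
    density. *)
Lemma shell_integral (d e c : R) (w : R -> R) : 0 < d -> d < e -> e <= 2 -> c != 0 ->
  measurable_fun setT w -> (forall y, 0 <= w y) -> (forall y, w (- y) = w y) ->
  (forall y, 0 < y -> w y * y `^ (- (1 + alpha)) = y `^ (c - 1)) ->
  (\int[nu]_(y in shell d e) (w y)%:E <= (2 * M * ((e `^ c - d `^ c) / c))%:E)%E.
Proof.
move=> d0 de e2 c0 mw w0 wN wpow.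
have mD : measurable (shell d e : set (measurableTypeR R)) := measurable_shell d e.
have Doo := shell_fin e d0.
pose m := mfrestr mD Doo : {finite_measure set (measurableTypeR R) -> \bar R}.
have m_sym : symmetric_measure m.
  by apply: mfrestr_symmetric => // x; rewrite /shell/= normrN.
have m_f : has_density m (f \_ (shell d e)) by exact: mfrestr_density.
(* Symmetry folds the shell onto its positive half, which explains the factor 2 and leaves a power
   of [y] to integrate. *)
pose g (y : R) : \bar R := (w y * (0 < y)%R%:R)%:E.
have mg : measurable_fun setT g.
  apply/measurable_EFinP; apply: measurable_funM => //.
  have -> : (fun y : R => (0 < y)%R%:R) = \1_(`]0, +oo[) :> (R -> R).
    by apply/funext => y; rewrite indicE; congr ((nat_of_bool _)%:R); apply/idP/idP;
      rewrite inE/= in_itv/= andbT.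
  by apply: measurable_indic.
have g0 y : (0 <= g y)%E by rewrite lee_fin mulr_ge0.
have mgN : measurable_fun setT (fun y : R => g (- y)).
  by apply: (measurableT_comp mg); exact: measurable_funN.
have -> : (\int[nu]_(y in shell d e) (w y)%:E = \int[m]_y (g y + g (- (y : R))%R))%E.
  rewrite ge0_integral_mfrestr//; last 2 first.
  - exact: emeasurable_funD.
  - by move=> y; rewrite adde_ge0.
  apply: eq_integral => y; rewrite inE => /andP[dy _].
  have : y != 0 by rewrite -normr_gt0 (lt_trans d0).
  rewrite /g -EFinD wN -mulrDr oppr_gt0 => /lt_total/orP[] yy; rewrite yy (lt_gtF yy);
    by rewrite ?addr0 ?add0r mulr1.
rewrite ge0_integralD// (symmetric_integral m_sym mg g0) -mule2n.
have : (\int[m]_y g y <= (M * ((e `^ c - d `^ c) / c))%:E)%E.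
  rewrite (ge0_integral_density m_f)// EFinM -integral_powR_deriv//.
  rewrite -ge0_integralZl//; last 3 first.
  - apply/measurable_EFinP; apply: measurable_funTS; exact: measurable_powR.
  - by move=> y _; rewrite lee_fin powR_ge0.
  - by rewrite lee_fin ltW.
  rewrite [leRHS]integral_mkcond; apply: ge0_le_integral => //.
  - by move=> y _; rewrite mule_ge0// lee_fin; case: m_f.
  - apply: emeasurable_funM => //; apply/measurable_EFinP; by case: m_f.
  - have mI : measurable (`[d, e]%classic : set (measurableTypeR R)) by exact: measurable_itv.
    apply/(measurable_restrictT _ mI); apply: measurable_funTS.
    apply: measurable_funeM; apply/measurable_EFinP; exact: measurable_powR.
  - move=> y _; rewrite /g !patchE.
    case: ifPn => [|_]; last first.
      rewrite mule0; case: ifPn => // _.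
      by rewrite mule_ge0// lee_fin ?powR_ge0// ltW.
    rewrite inE => /andP[dy ye].
    case: (ltrP 0 y) => y0; last first.
      rewrite mulr0 mul0e; case: ifPn => // _.
      by rewrite mule_ge0// lee_fin ?powR_ge0// ltW.
    rewrite (gtr0_norm y0) in dy ye.
    rewrite mem_set; last by rewrite /= in_itv/= (ltW dy).
    rewrite mulr1 -!EFinM lee_fin -wpow// mulrCA ler_wpM2l//.
    have := f_L (x := y); rewrite /class_L/= (gtr0_norm y0); apply.
    by rewrite y0 (le_trans ye).
move=> H; rewrite mule2n -mulrA mulr_natl mulr2n EFinD.
exact: leeD.
Qed.

Lemma shell_mass (d e : R) : 0 < d -> d < e -> e <= 2 ->
  (nu (shell d e) <= (2 * M * d `^ (- alpha) / alpha)%:E)%E.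
Proof.
move=> d0 de e2; have mD := measurable_shell d e.
have := @shell_integral d e (- alpha) (fun=> 1) d0 de e2.
rewrite integral_cst// mul1e oppr_eq0 gt_eqF// => H.
have {H} := H isT (@measurable_cst _ _ _ _ _ _) (fun=> ler01) (fun=> erefl).
move=> H; apply: (le_trans (H _)) => [y y0|].
  by rewrite mul1r; congr (_ `^ _); ring.
rewrite lee_fin -!mulrA ler_pM2l// ler_pM2l// invrN mulrN -mulNr opprB.
by rewrite ler_pM2r ?invr_gt0// gerBl powR_ge0.
Qed.

Lemma shell_variance (d e : R) : 0 < d -> d < e -> e <= 2 ->
  (\int[nu]_(y in shell d e) (y ^+ 2)%:E <= (2 * M * e `^ (2 - alpha) / (2 - alpha))%:E)%E.
Proof.
move=> d0 de e2.
have a2 : 0 < 2 - alpha by rewrite subr_gt0.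
apply: (le_trans (@shell_integral d e (2 - alpha) (fun y => y ^+ 2) d0 de e2 _ _ _ _ _)).
- by rewrite gt_eqF.
- exact: measurable_funX.
- by move=> y; exact: sqr_ge0.
- by move=> y; rewrite sqrrN.
- move=> y y0; rewrite -powR_mulrn ?(ltW y0)// -powRD.
    by congr (_ `^ _); ring.
  by rewrite (gt_eqF y0)/= implybT.
rewrite lee_fin -!mulrA ler_pM2l// ler_pM2l//.
by rewrite ler_pM2r ?invr_gt0// gerBl powR_ge0.
Qed.

Lemma lambdaE (a : R) : lambda f a = fine (nu [set y | a < `|y|]).
Proof.
have [_ _ nuf] := nu_f; rewrite /lambda /Rintegral nuf//.
exact: measurable_norm_gt.
Qed.

(** The tail is cut at 1: the class bounds the shell between [d] and 1, and the rest is
    [lambda f 1]. *)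
Lemma lambda_le (d : R) : 0 < d -> d < 1 ->
  lambda f d <= 2 * M * d `^ (- alpha) / alpha + lambda f 1.
Proof.
move=> d0 d1; rewrite !lambdaE.
have E : [set y : R | d < `|y|] = shell d 1 `|` [set y | 1 < `|y|].
  apply/seteqP; split => y /=; last by case=> [/andP[]//|]; exact: lt_trans.
  by rewrite /shell/= => ->/=; case: (lerP `|y| 1) => ?; [left|right].
have finL := levy_tail_fin ltr01 nu_levy.
have finS := shell_fin 1 d0.
have sm := shell_mass d0 d1 (ltW (ltr1n R 2)).
have H : (nu [set y | (d < `|y|)%R] <= nu (shell d 1) + nu [set y | (1 < `|y|)%R])%E.
  rewrite E; apply: measureU2; [exact: measurable_shell|exact: measurable_norm_gt].
rewrite -lee_fin EFinD fineK ?ge0_fin_numE// ?(levy_tail_fin d0)//.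
rewrite fineK ?ge0_fin_numE//.
apply: (le_trans H); exact: leeD.
Qed.

End ShellBounds.

Lemma measurable_translate {R : realType} (A : set R) (x : R) :
  measurable A -> measurable [set y : R | A (x + y)].
Proof.
move=> mA; rewrite -[X in measurable X]setTI.
by apply: (measurable_funD (measurable_cst x) (@measurable_id _ _ _)).
Qed.

Lemma convol_indic {R : realType} (m : {finite_measure set (measurableTypeR R) -> \bar R})
    (A : set R) (x : R) : measurable A ->
  convol m \1_A x = fine (m [set y : R | A (x + y)]).
Proof.
move=> mA; rewrite /convol /Rintegral; congr fine.
have mS : measurable ([set y : R | A (x + y)] : set (measurableTypeR R)).
  exact: measurable_translate.
by have := integral_indic m measurableT mS; rewrite setIT.
Qed.

(** * How a small displacement changes the probability that a big jump exceeds the threshold *)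

Section BigJumpTail.
Context {R : realType} (nu : {measure set (measurableTypeR R) -> \bar R}).
Context (f : R -> R).
Context (nu_levy : levy_measure nu) (nu_sym : symmetric_measure nu)
  (nu_f : has_density nu f).
Local Notation mu := (@lebesgue_measure R).

Let hi (z : R) : set R := [set y | z < y].
Let lo (z : R) : set R := [set y | y < z].
Let oc (u v : R) : set R := [set y | u < y <= v].

Let ocE u v : oc u v = `]u, v]%classic.
Proof. by apply/seteqP; split => y; rewrite /oc /lo /= in_itv. Qed.

Let m_hi z : measurable (hi z).
Proof.
have -> : hi z = `]z, +oo[%classic; last exact: measurable_itv.
by apply/seteqP; split => y; rewrite /hi /= in_itv/= andbT.
Qed.

Let m_lo z : measurable (lo z).
Proof.
have -> : lo z = `]-oo, z[%classic; last exact: measurable_itv.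
by apply/seteqP; split => y; rewrite /oc /lo /= in_itv.
Qed.

Let m_oc u v : measurable (oc u v).
Proof. by rewrite ocE; exact: measurable_itv. Qed.

Let T (z : R) : R := fine (nu (hi z)).

Let T_fin (z : R) : 0 < z -> nu (hi z) \is a fin_num.
Proof.
move=> z0; rewrite ge0_fin_numE//; apply: le_lt_trans (levy_tail_fin z0 nu_levy).
apply: le_measure; rewrite ?inE; [exact: m_hi|exact: measurable_norm_gt|].
by move=> y; rewrite /hi /= => /lt_le_trans; apply; exact: ler_norm.
Qed.

Let T_neg (z : R) : nu (lo (- z)%R) = nu (hi z).
Proof.
rewrite -[RHS]nu_sym; last exact: m_hi.
congr (nu _); apply/seteqP; split => [y|_ [y + <-]]; rewrite /hi /lo /=.
  by move=> yz; exists (- y); rewrite ?opprK//= ltrNr.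
by rewrite ltrN2.
Qed.

(** For so small a displacement, passing [eps] already forces [eta < |y|], so the set is a union of
    two half-lines; symmetry of [nu] reflects the left one. *)
Let two_tails (eta eps x : R) : 0 < eta -> eta <= eps - `|x| ->
  fine (nu ([set y : R | eps < `|x + y|] `&` [set y | eta < `|y|])) =
  T (eps - `|x|) + T (eps + `|x|).
Proof.
move=> eta0 ex.
have xn := normr_ge0 x; have /andP[x1 x2] : - `|x| <= x <= `|x| by rewrite -ler_norml.
have -> : [set y : R | eps < `|x + y|] `&` [set y | eta < `|y|] =
    hi (eps - x)%R `|` lo (- (eps + x))%R.
  apply/seteqP; split => y; rewrite /hi /lo /oc /=.
    by move=> []; rewrite ltr_normr; case/orP => ? _; [left|right]; lra.
  case=> ye; split.
  - by rewrite (lt_le_trans _ (ler_norm _))//; lra.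
  - by rewrite (lt_le_trans _ (ler_norm _))//; lra.
  - by rewrite -normrN (lt_le_trans _ (ler_norm _))//; lra.
  - by rewrite -normrN (lt_le_trans _ (ler_norm _))//; lra.
have I : hi (eps - x)%R `&` lo (- (eps + x))%R = set0.
  by apply/seteqP; split => // y []; rewrite /hi /lo /oc /=; lra.
have -> : nu (hi (eps - x) `|` lo (- (eps + x))) = (nu (hi (eps - x)) + nu (lo (- (eps + x))))%E.
  by apply: measureU; [exact: m_hi|exact: m_lo|exact: I].
rewrite T_neg fineD; [|apply: T_fin; lra|apply: T_fin; lra].
rewrite -/(T _) -/(T _).
by case: (ger0P x) => // _; rewrite addrC opprK.
Qed.

Let T_split (u v : R) : 0 < u -> u <= v ->
  T u = T v + fine (nu (oc u v)).
Proof.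
move=> u0 uv.
have E : hi u = oc u v `|` hi v.
  apply/seteqP; split => y; rewrite /hi /lo /oc /=.
    by move=> ->; case: (lerP y v) => /=; [left|right].
  by case=> [/andP[]//|]; exact: le_lt_trans.
have I : (oc u v `&` hi v = set0).
  by apply/seteqP; split => // y []; rewrite /hi /lo /oc /=; lra.
have U : nu (oc u v `|` hi v) = (nu (oc u v) + nu (hi v))%E.
  by apply: measureU; [exact: m_oc|exact: m_hi|exact: I].
rewrite /T E U.
rewrite fineD 1?addrC//; last by apply: T_fin; lra.
rewrite ge0_fin_numE//; apply: (@le_lt_trans _ _ (nu (hi u))).
  apply: le_measure; rewrite ?inE; [exact: m_oc|exact: m_hi|].
  by rewrite E; exact: subsetUl.
by rewrite -ge0_fin_numE//; exact: T_fin.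
Qed.

Let itv_bounds (u v c1 c2 : R) : u <= v -> 0 <= c2 ->
  (forall y, u < y <= v -> c1 <= f y <= c2) ->
  c1 * (v - u) <= fine (nu (oc u v)) <= c2 * (v - u).
Proof.
move=> uv c20 fc; have [mf f0 nuf] := nu_f.
have mI := m_oc u v.
have muI : mu (oc u v) = (v - u)%:E.
  rewrite ocE lebesgue_measure_itv/= lte_fin.
  move: uv; rewrite le_eqVlt => /predU1P[->|->]; last by rewrite -EFinB.
  by rewrite ltxx subrr.
have H2 : (nu (oc u v) <= (c2 * (v - u))%:E)%E.
  rewrite nuf// EFinM -muI -integral_cst//; apply: ge0_le_integral => //.
  - by move=> y _; rewrite lee_fin.
  - by apply/measurable_EFinP; exact: measurable_funTS.
  - by move=> y /=; rewrite lee_fin => /fc /andP[].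
have H1 : ((c1 * (v - u))%:E <= nu (oc u v))%E.
  (* The lower bound is later [f eps - L * s], which may be negative; then nonnegativity of [nu]
     suffices. *)
  have [c1le|c1gt] := lerP c1 0.
    rewrite (@le_trans _ _ 0%E)// lee_fin; rewrite mulr_le0_ge0//; lra.
  rewrite nuf// EFinM -muI -integral_cst//; apply: ge0_le_integral => //.
  - by move=> y _; rewrite lee_fin ltW.
  - by apply/measurable_EFinP; exact: measurable_funTS.
  - by move=> y /=; rewrite lee_fin => /fc /andP[].
have nfin : nu (oc u v) \is a fin_num.
  by rewrite ge0_fin_numE// (le_lt_trans H2)// ltry.
by rewrite -!lee_fin fineK// H1.
Qed.

(* The tails [T (eps - s)] and [T (eps + s)] differ from [T eps] by nearly
   opposite amounts [s * f eps], up to the Lipschitz error. *)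
Lemma two_tails_quad (eta eps L r x : R) : 0 < eta -> 0 <= L -> eta <= eps - r -> `|x| < r ->
  (forall y, `|y - eps| < r -> `|f y - f eps| <= L * `|y - eps|) ->
  `|fine (nu ([set y : R | eps < `|x + y|] `&` [set y | eta < `|y|])) -
    fine (nu [set y : R | eps < `|y|])| <= 2 * L * x ^+ 2.
Proof.
move=> eta0 L0 er xr fL; have [mf f0 nuf] := nu_f.
have s0 := normr_ge0 x; rewrite -(real_normK (num_real x)).
rewrite (@two_tails eta)//; last lra.
(* The undisplaced tail is the case [x = 0] of [two_tails], namely [2 * T eps]. What remains is the
   difference of the masses of two adjacent intervals of length [s]. *)
have -> : [set y : R | eps < `|y|] =
    [set y : R | eps < `|0 + y|] `&` [set y | eta < `|y|].
  apply/seteqP; split => y /=; rewrite add0r; last by case.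
  by move=> ye; split=> //; lra.
rewrite (@two_tails eta)//; last by rewrite normr0; lra.
rewrite normr0 subr0 addr0.
move: (`|x|) s0 xr => s s0 sr.
have fs y : `|y - eps| <= s -> f eps - L * s <= f y <= f eps + L * s.
  move=> ys; have := fL y (le_lt_trans ys sr).
  have := ler_wpM2l L0 ys; rewrite ler_norml => + /andP[]; lra.
have c0 : 0 <= f eps + L * s by rewrite addr_ge0// mulr_ge0.
have e0 : 0 < eps - s by lra.
rewrite (T_split e0 (_ : _ <= eps)); last lra.
rewrite (@T_split eps (eps + s)); [|lra|lra].
have f1 y : eps - s < y <= eps -> f eps - L * s <= f y <= f eps + L * s.
  by move=> /andP[? ?]; apply: fs; rewrite ler_norml; lra.
have f2 y : eps < y <= eps + s -> f eps - L * s <= f y <= f eps + L * s.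
  by move=> /andP[? ?]; apply: fs; rewrite ler_norml; lra.
have l1 : eps - s <= eps by lra.
have l2 : eps <= eps + s by lra.
have /andP[] := itv_bounds l1 c0 f1; have /andP[] := itv_bounds l2 c0 f2.
move: (fine _) (fine _) => a b.
rewrite ler_norml; nra.
Qed.

End BigJumpTail.

(** * Replacing the open unbounded event by a compact shell *)

Section InnerApproximation.
Context {R : realType} (m : {finite_measure set (measurableTypeR R) -> \bar R}).
Context (h : R -> R) (m_h : has_density m h).
Local Notation mu := (@lebesgue_measure R).

Let m_fin (A : set R) : measurable A -> m A \is a fin_num.
Proof. by move=> mA; exact: fin_num_measure. Qed.

(** Absolute continuity of the integral of [h]. Since Lebesgue measure is translation invariant, the
    smallness is uniform over translates, that is over the position of the walk. *)
Lemma density_uniformly_small (e : R) : 0 < e ->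
  exists2 d : R, 0 < d & forall A : set R, measurable A -> (mu A < d%:E)%E ->
    fine (m A) < e.
Proof.
move=> e0; have [mh h0 mA] := m_h.
have ih : mu.-integrable setT (EFin \o h).
  apply/integrableP; split; first exact/measurable_EFinP.
  under eq_integral => x _ do rewrite /= ger0_norm//.
  by rewrite -mA// -ge0_fin_numE//; exact: m_fin.
have [d [d0 H]] := integral_normr_continuous ih e0.
exists d => // A measA /(H _ measA); rewrite /Rintegral mA//.
by under eq_integral => x _ do rewrite ger0_norm//.
Qed.

Let tail_small (e : R) : 0 < e ->
  \forall n \near \oo, fine (m [set y : R | n%:R / 2 < `|y|]) < e.
Proof.
move=> e0; pose F n : set R := [set y : R | n%:R / 2 < `|y|].
have mF n : measurable (F n) by exact: measurable_norm_gt.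
have F0 : \bigcap_n F n = set0.
  apply/seteqP; split => // y /= Fy.
  have y2 : 0 <= 2 * `|y| by rewrite mulr_ge0.
  have /andP[_ lt1] := truncn_itv y2.
  have := Fy (Num.trunc (2 * `|y|)).+1 I; rewrite /F/=.
  move: lt1; set k : R := _.+1%:R; lra.
have niF : nonincreasing_seq F.
  move=> i j ij; apply/subsetPset => y; rewrite /F/=; apply: le_lt_trans.
  by rewrite ler_pM2r// ler_nat.
have Fcvg : m \o F @ \oo --> m (\bigcap_n F n).
  apply: nonincreasing_cvg_mu => //.
  - by rewrite -ge0_fin_numE//; exact: m_fin.
  - exact: bigcapT_measurable.
rewrite F0 measure0 in Fcvg.
have /fine_cvg/(@cvgr_lt _ _ _ _ _ _) := Fcvg.
by move=> /(_ _ e0).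
Qed.

(** No shell works uniformly in [x], because a far displacement carries jumps beyond [c]. The term
    [e * x ^+ 2] pays for this, in the form that the second-moment estimate accepts. *)
Lemma inner_approximation (eps e : R) : 0 <= eps -> 0 < e ->
  exists b c : R, [/\ eps < b, b <= c & forall x,
    convol m \1_[set z | eps < `|z|] x <=
    convol m \1_[set z | b <= `|z| <= c] x + (2 * e + e * x ^+ 2)].
Proof.
move=> eps0 e0.
have [d d0 Hd] := density_uniformly_small e0.
(* The lost set consists of two intervals of length [d / 4], of total measure below [d]. *)
pose b := eps + d / 4.
have epsb : eps < b by rewrite /b ltrDl divr_gt0.
pose mT := fine (m setT).
have mT0 : 0 <= mT by exact: fine_ge0.
(* If [|x| <= n / 2], leaving the radius [n] takes a jump larger than [n / 2]; otherwise the last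
   condition bounds the total mass by [e * x ^+ 2]. *)
have [n [n1 n2 n3]] : exists n : nat, [/\ fine (m [set y : R | n%:R / 2 < `|y|]) < e,
    b <= n%:R & 4 * mT <= e * n%:R ^+ 2].
  have c1 := tail_small e0.
  have c2 := nbhs_infty_ger b.
  have c3 := nbhs_infty_ger (4 * mT / e).
  have c4 := nbhs_infty_ge 1.
  have [n _ /(_ n (leqnn n))[/= H1 [H2 [H3 H4]]]] := filterI c1 (filterI c2 (filterI c3 c4)).
  exists n; split => //.
  rewrite ler_pdivrMr// in H3; rewrite (le_trans H3)// mulrC ler_wpM2l ?(ltW e0)//.
  by rewrite expr2 ler_peMl// ler1n.
have m1 := measurable_norm_gt eps.
have m2 := measurable_norm_itv b n%:R.
have m3 : measurable [set z : R | eps < `|z| < b].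
  have -> : [set z : R | eps < `|z| < b] = [set z | eps < `|z|] `\` [set z | b <= `|z| <= `|z|].
    apply/seteqP; split => z /=; rewrite lexx andbT.
      by move=> /andP[-> ?]; split => //; apply/negP; rewrite -ltNge.
    by move=> [-> /negP]; rewrite -ltNge.
  have -> : [set z | b <= `|z| <= `|z|] = (@Num.norm R R) @^-1` `[b, +oo[.
    by apply/seteqP; split => x /=; rewrite in_itv/= lexx !andbT.
  apply: measurableD => //.
  by rewrite -[X in measurable X]setTI; exact: normr_measurable.
have m4 := measurable_norm_gt (n%:R : R).
exists b, n%:R; split => // x.
have bi (D : set R) : measurable D -> bounded_measurable (\1_D : R -> R) by exact: bmf_indic.
apply: (@le_trans _ _ (convol m (fun z => \1_[set z | b <= `|z| <= n%:R] z +
   (\1_[set z : R | eps < `|z| < b] z + \1_[set z : R | n%:R < `|z|] z)) x)).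
  apply: convol_le; [exact: bi| |].
    by apply: bmfD; [exact: bi|apply: bmfD; exact: bi].
  move=> z; rewrite !indicE.
  have E (Q : R -> bool) : (z \in [set z | Q z]) = Q z by apply/idP/idP; rewrite inE.
  rewrite !E; case: (ltrP eps `|z|) => /= [_|_]; last by rewrite addr_ge0// addr_ge0.
  by case: (lerP b `|z|) => /= _; case: (lerP `|z| n%:R) => /= _; rewrite ?addr0 ?add0r ?lerDl ?ler01//.
have bmD : bounded_measurable (fun z : R => \1_[set z | eps < `|z| < b] z + \1_[set z : R | n%:R < `|z|] z : R).
  by apply: bmfD; exact: bi.
rewrite (convolD _ _ (bi _ m2) bmD) lerD2l (convolD _ _ (bi _ m3) (bi _ m4)).
have xx0 : 0 <= e * x ^+ 2 by rewrite mulr_ge0 ?sqr_ge0// ltW.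
have W1 : convol m \1_[set z : R | eps < `|z| < b] x < e.
  rewrite convol_indic//; apply: Hd.
    exact: (measurable_translate x m3).
  have s : [set y : R | eps < `|x + y| < b] `<=`
      `[(eps - x)%R, (b - x)%R]%classic `|` `[(- b - x)%R, (- eps - x)%R]%classic.
    move=> y /=; rewrite !in_itv/= => /andP[].
    rewrite ltr_normr ltr_norml => /orP[] ? /andP[? ?]; [left|right]; lra.
  apply: (@le_lt_trans _ _ (mu (`[(eps - x)%R, (b - x)%R]%classic `|` `[(- b - x)%R, (- eps - x)%R]%classic))).
    apply: le_measure; rewrite ?inE//.
      exact: (measurable_translate x m3).
    by apply: measurableU; exact: measurable_itv.
  apply: (@le_lt_trans _ _ ((d / 4)%:E + (d / 4)%:E)%E).
    have U (A B : set R) : measurable A -> measurable B -> (mu (A `|` B) <= mu A + mu B)%E.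
      by move=> mA mB; exact: measureU2.
    apply: (le_trans (U _ _ (measurable_itv _) (measurable_itv _))).
    by rewrite !lebesgue_measure_itv/= !lte_fin; apply: leeD; case: ifPn => _;
      rewrite -?EFinB lee_fin /b ?divr_ge0 ?(ltW d0)//; lra.
  by rewrite -EFinD lte_fin; lra.
suff : convol m \1_[set z : R | n%:R < `|z|] x <= e + e * x ^+ 2 by lra.
rewrite convol_indic//.
have mx : measurable [set y : R | n%:R < `|x + y|].
  exact: (measurable_translate x m4).
have [xn|xn] := lerP `|x| (n%:R / 2).
  apply: (@le_trans _ _ (fine (m [set y : R | n%:R / 2 < `|y|]))); last lra.
  have m5 := measurable_norm_gt (n%:R / 2 : R).
  apply: fine_le; [exact: m_fin|exact: m_fin|].
  apply: le_measure; rewrite ?inE//.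
  by move=> y /=; have := ler_normD x y; lra.
apply: (@le_trans _ _ mT).
  apply: fine_le; [exact: m_fin|exact: m_fin|].
  by apply: le_measure; rewrite ?inE.
have xn2 : n%:R ^+ 2 / 4 <= x ^+ 2.
  have -> : n%:R ^+ 2 / 4 = (n%:R / 2 : R) ^+ 2 by field.
  by rewrite -(real_normK (num_real x)) lerXn2r ?nnegrE ?divr_ge0// ltW.
have := ler_wpM2l (ltW e0) xn2.
by move: n3; lra.
Qed.

End InnerApproximation.

(** * Approximation of the process by random walks *)

Section Elementary.
Context {R : realType}.
Implicit Types x y z : R.

Lemma sin_norm_le x : 0 <= x -> `|sin x| <= x.
Proof.
move=> x0.
have mono (s : R) : `|s| <= 1 -> 0 <= x + s * sin x.
  move=> s1; pose h (r : R) := r + s * sin r.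
  have dh (r : R) : is_derive r (1 : R) h (1 + s * cos r).
    by rewrite /h; apply: is_derive_eq; rewrite /GRing.scale /=; ring.
  have : h 0 <= h x.
    apply: (@ger0_derive1_le_cc _ h 0 x) => //; try by rewrite in_itv/= ?lexx ?x0.
    - move=> r _; rewrite derive1E derive_val.
      have : `|s * cos r| <= 1 by rewrite normrM mulr_ile1// cos_max.
      by rewrite ler_norml; lra.
    - apply: continuous_subspaceT => r.
      by apply: differentiable_continuous; exact/derivable1_diffP.
  by rewrite /h sin0 mulr0 addr0.
rewrite ler_norml; have := mono 1; have := mono (-1).
by rewrite normrN normr1 => /(_ (lexx _)) + /(_ (lexx _)); lra.
Qed.

Lemma onem_cos_le x : 0 <= 1 - cos x <= x ^+ 2.
Proof.
rewrite subr_ge0 cos_le1/=.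
have -> : cos x = 1 - 2 * sin (`|x| / 2) ^+ 2.
  rewrite -cos_norm {1}[`|x|]splitr cosD -!expr2.
  by have := cos2Dsin2 (`|x| / 2); lra.
have x0 : 0 <= `|x| / 2 by rewrite divr_ge0.
have : sin (`|x| / 2) ^+ 2 <= (`|x| / 2) ^+ 2.
  by rewrite -[leLHS]real_normK ?num_real// lerXn2r ?nnegrE// sin_norm_le.
have -> : (`|x| / 2) ^+ 2 = x ^+ 2 / 4.
  by rewrite expr_div_n real_normK ?num_real// -natrX.
have := sqr_ge0 x; lra.
Qed.

Lemma ler_subX (a b : R) n : 0 <= a -> a <= b -> b <= 1 -> b ^+ n - a ^+ n <= n%:R * (b - a).
Proof.
move=> a0 ab b1; elim: n => [|n IH]; first by rewrite !expr0 subrr mul0r.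
have an0 : 0 <= a ^+ n by rewrite exprn_ge0.
have an1 : a ^+ n <= 1 by rewrite exprn_ile1// (le_trans ab).
have abn : 0 <= b ^+ n - a ^+ n by rewrite subr_ge0 lerXn2r ?nnegrE// (le_trans a0).
rewrite !exprSr -natr1; nra.
Qed.

(** An explicit rate is wanted because [z] and the number of steps vary together along the
    approximation. It comes from [b ^ n - a ^ n <= n * (b - a)] with [a = 1 - y], [b = expR (- y)]
    and [y = z / n.+1]. *)
Lemma expRN_approx z n : 0 <= z <= n.+1%:R ->
  `|(1 - z / n.+1%:R) ^+ n.+1 - expR (- z)| <= z ^+ 2 / n.+1%:R.
Proof.
move=> /andP[z0 zn]; set N : R := n.+1%:R.
have N0 : 0 < N by [].
pose y := z / N.
have y0 : 0 <= y by rewrite divr_ge0.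
have y1 : y <= 1 by rewrite ler_pdivrMr// mul1r.
have -> : - z = n.+1%:R * (- y) by rewrite /y -/N; field; rewrite gt_eqF.
rewrite expRM_natl -/y.
have ab : 1 - y <= expR (- y) by exact: expR_ge1Dx.
have b1 : expR (- y) <= 1 by rewrite expR_le1 oppr_le0.
(* Follows from [1 + y <= expR y] and [(1 - y + y ^ 2) * (1 + y) = 1 + y ^ 3 >= 1]. *)
have b2 : expR (- y) <= 1 - y + y ^+ 2.
  rewrite expRN -div1r ler_pdivrMr ?expR_gt0//.
  have := expR_ge1Dx y.
  have : 0 <= 1 - y + y ^+ 2 by nra.
  move=> /ler_wpM2l H /H; apply: le_trans.
  have := mulr_ge0 y0 (sqr_ge0 y); rewrite expr2; nra.
have a0 : 0 <= 1 - y by rewrite subr_ge0.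
rewrite distrC ger0_norm; last by rewrite subr_ge0 lerXn2r ?nnegrE ?expR_ge0.
apply: (le_trans (ler_subX n.+1 a0 ab b1)).
rewrite -/N -ler_pdivlMl// (le_trans (_ : _ <= y ^+ 2))//; first lra.
by rewrite /y le_eqVlt; apply/orP; left; apply/eqP; field; rewrite gt_eqF.
Qed.

End Elementary.

(** * The sequence of walks and the convergence of its characteristic functions *)

Section ApproximatingWalk.
Context {R : realType} (nu : {measure set (measurableTypeR R) -> \bar R}).
Context (nu_levy : levy_measure nu) (nu_sym : symmetric_measure nu).
Context (eta t : R) (eta0 : 0 < eta) (t0 : 0 < t).

(** The offset 2 keeps the level strictly below [eta] from [k = 0] on. *)
Local Notation trunc_level k := (eta / k.+2%:R).

Let level_gt0 k : 0 < trunc_level k. Proof. by rewrite divr_gt0. Qed.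

Let level_lt k : trunc_level k < eta.
Proof. by rewrite ltr_pdivrMr// ltr_pMr// ltr1n. Qed.

Definition small_jumps k : {finite_measure set (measurableTypeR R) -> \bar R} :=
  mfrestr (measurable_shell (trunc_level k) eta : measurable (_ : set (measurableTypeR R)))
    (shell_fin nu_levy eta (level_gt0 k)).

Definition big_jumps : {finite_measure set (measurableTypeR R) -> \bar R} :=
  mfrestr (measurable_norm_gt eta : measurable (_ : set (measurableTypeR R)))
    (levy_tail_fin eta0 nu_levy).

Lemma small_jumps_sym k : symmetric_measure (small_jumps k).
Proof. by apply: mfrestr_symmetric => // x; rewrite /shell/= normrN. Qed.

Lemma big_jumps_sym : symmetric_measure big_jumps.
Proof. by apply: mfrestr_symmetric => // x; rewrite /= normrN. Qed.

Lemma small_jumps_ae k : {ae small_jumps k, forall y, `|y| <= eta}.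
Proof.
exists [set y | eta < `|y|]; split.
- exact: measurable_norm_gt.
- transitivity (nu ([set y | eta < `|y|] `&` shell (trunc_level k) eta)); first by [].
  rewrite (_ : _ `&` _ = set0) ?measure0//.
  by apply/seteqP; split => // y [/=]; rewrite /shell/= => ? /andP[_]; lra.
- by move=> y /= /negP; rewrite -ltNge.
Qed.

Let mass k := fine (small_jumps k setT) + fine (big_jumps setT).

Let mass_ge0 k : 0 <= mass k. Proof. by rewrite addr_ge0// fine_ge0. Qed.

(** A single index drives both limits: the jump mass may diverge as the truncation level tends to 0,
    so the number of steps must outgrow its square. The walk makes [(steps k).+1] steps, which
    matches the [n.+1] of the one-jump bounds. *)
Let steps k : nat := Num.trunc (k.+1%:R * (1 + t * mass k) ^+ 2).

Let tm0 k : 0 <= t * mass k. Proof. by rewrite mulr_ge0// ltW. Qed.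

Let steps_ge k : k.+1%:R * (1 + t * mass k) ^+ 2 <= (steps k).+1%:R.
Proof.
have pos : 0 <= k.+1%:R * (1 + t * mass k) ^+ 2 by rewrite mulr_ge0// sqr_ge0.
by have /andP[_ /ltW] := truncn_itv pos.
Qed.

Let step_time k : R := t / (steps k).+1%:R.

Let total_time k : (steps k).+1%:R * step_time k = t.
Proof. by rewrite /step_time mulrC divfK. Qed.

Let step_time_ge0 k : 0 <= step_time k.
Proof. by rewrite divr_ge0// ltW. Qed.

Let steps_ge2 k : (1 + t * mass k) ^+ 2 <= (steps k).+1%:R.
Proof.
apply: le_trans (steps_ge k); rewrite ler_peMl ?sqr_ge0// ler1n//.
Qed.

Let step_mass k : step_time k * (fine (small_jumps k setT) + fine (big_jumps setT)) <= 1.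
Proof.
rewrite -/(mass k) /step_time mulrAC ler_pdivrMr// mul1r.
have := steps_ge2 k; have := tm0 k; have := sqr_ge0 (t * mass k).
move: (t * mass k) => x; rewrite !expr2; lra.
Qed.

Definition walk k (g : R -> R) : R :=
  iter (steps k).+1 (step (small_jumps k) big_jumps (step_time k)) g 0.

Lemma walk_lin k a g h : bounded_measurable g -> bounded_measurable h ->
  walk k (fun x => g x + a * h x) = walk k g + a * walk k h.
Proof. by move=> bg bh; rewrite /walk iter_step_lin. Qed.

Lemma walk_le k g h : bounded_measurable g -> bounded_measurable h ->
  (forall x, g x <= h x) -> walk k g <= walk k h.
Proof. by move=> bg bh gh; exact: iter_step_le. Qed.

Lemma walk_cst k c : walk k (fun=> c) = c.
Proof. by rewrite /walk iter_step_cst. Qed.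

Let exponent u k : R := fine (\int[nu]_(y in [set y | trunc_level k < `|y|]) (1 - cos (u * y))%:E).

Let measurable_onem_cos u : measurable_fun setT (fun y : R => 1 - cos (u * y)).
Proof. by apply: measurable_funB => //; have [] := bmf_cos u. Qed.

Let onem_cos_ge0 (u y : R) : 0 <= 1 - cos (u * y).
Proof. by have /andP[] := onem_cos_le (u * y). Qed.

Let integrable_onem_cos (m : {finite_measure set (measurableTypeR R) -> \bar R}) u :
  m.-integrable setT (EFin \o (fun y => 1 - cos (u * y))).
Proof.
apply: (bmf_integrable m (X := id) (g := fun y => 1 - cos (u * y))) => //.
by apply: bmfD; [exact: bmf_cst|apply: bmfN; exact: bmf_cos].
Qed.

Let exponentE u k : exponent u k =
  \int[small_jumps k]_y (1 - cos (u * y)) + \int[big_jumps]_y (1 - cos (u * y)).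
Proof.
have mEF : measurable_fun setT (fun y : R => (1 - cos (u * y))%:E).
  exact/measurable_EFinP.
rewrite /Rintegral -fineD; last 2 first.
- exact: (integrable_fin_num _ (integrable_onem_cos (small_jumps k) u)).
- exact: (integrable_fin_num _ (integrable_onem_cos big_jumps u)).
rewrite /exponent; congr fine.
rewrite !ge0_integral_mfrestr//; try by move=> y; rewrite lee_fin.
rewrite -ge0_integral_setU.
- congr integral; apply/seteqP; split => y /=; last first.
    by case=> [/andP[]//|]; exact: lt_trans.
  by rewrite /shell/= => ->; case: (lerP `|y| eta); [left|right].
- exact: measurable_shell.
- exact: measurable_norm_gt.
- exact: measurable_funTS.
- by move=> y _; rewrite lee_fin.
- by apply/disj_setPS => y [/andP[_]/=]; lra.
Qed.

Let exponent_bounds u k : 0 <= t * exponent u k <= 2 * (t * mass k).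
Proof.
have H (m : {finite_measure set (measurableTypeR R) -> \bar R}) :
    0 <= \int[m]_y (1 - cos (u * y)) <= 2 * fine (m setT).
  rewrite Rintegral_ge0//= -(Rintegral_cst _ measurableT).
  apply: le_Rintegral => //.
    exact: integrable_onem_cos.
    exact: (bmf_integrable m (X := id) (g := fun y => 2) _ (bmf_cst 2)).
  by move=> y _; have := cos_geN1 (u * y); lra.
rewrite exponentE mulrCA !ler_pM2l// mulr_ge0 ?(ltW t0)//=.
  have /andP[_ h1] := H (small_jumps k); have /andP[_ h2] := H big_jumps.
  by rewrite /mass; lra.
by have /andP[h1 _] := H (small_jumps k); have /andP[h2 _] := H big_jumps; lra.
Qed.

(** With [x = t * mass k], the exponent is at most [2 * x] and there are at least
    [k.+1 * (1 + x) ^ 2] steps, so [expRN_approx] yields [4 / k.+1]. *)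
Let walk_cos u k : `|walk k (fun x => cos (u * x)) - expR (- (t * exponent u k))| <=
  4 / k.+1%:R.
Proof.
rewrite /walk iter_step_cos; [|exact: small_jumps_sym|exact: big_jumps_sym].
rewrite -exponentE mulr0 cos0 mulr1.
have -> : step_time k * exponent u k = t * exponent u k / (steps k).+1%:R.
  by rewrite /step_time mulrAC.
have /andP[z0 z2] := exponent_bounds u k.
have sm := steps_ge2 k; have := steps_ge k; have tm := tm0 k.
move: (t * exponent u k) (t * mass k) (steps k) z0 z2 sm tm => z x N z0 zx xN x0 kxN.
have N0 : 0 < N.+1%:R :> R by [].
have zN : 0 <= z <= N.+1%:R.
  by rewrite z0/=; have := sqr_ge0 x; move: xN; rewrite !expr2; lra.
apply: (le_trans (expRN_approx zN)).
rewrite ler_pdivrMr//.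
have k0 : 0 < k.+1%:R :> R by [].
rewrite mulrAC ler_pdivlMr// (@le_trans _ _ (4 * (k.+1%:R * (1 + x) ^+ 2)))//.
  rewrite mulrC [leRHS]mulrCA ler_pM2l//.
  have -> : 4 * (1 + x) ^+ 2 = (2 * (1 + x)) ^+ 2 by ring.
  by rewrite lerXn2r ?nnegrE//; lra.
by rewrite ler_pM2l.
Qed.

Lemma integrable_levy_onem_cos u :
  nu.-integrable setT (EFin \o (fun y : R => 1 - cos (u * y))).
Proof.
have [_ fin] := nu_levy.
apply/integrableP; split.
  by apply/measurable_EFinP; exact: measurable_onem_cos.
have c0 : 0 <= 2 + u ^+ 2 by rewrite addr_ge0// sqr_ge0.
have mmin : measurable_fun (setT : set R) (fun y : R => (Num.min (y ^+ 2) 1)%:E).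
  by apply/measurable_EFinP; apply: measurable_minr => //; exact: measurable_funX.
have min0 y : (0 <= (Num.min (y ^+ 2) (1 : R))%:E)%E.
  by rewrite lee_fin le_min sqr_ge0 ler01.
apply: (@le_lt_trans _ _ ((2 + u ^+ 2)%:E * \int[nu]_y (Num.min (y ^+ 2) 1)%:E)%E); last first.
  by rewrite lte_mul_pinfty.
rewrite -ge0_integralZl//; apply: ge0_le_integral => //.
- by apply: measurableT_comp => //; apply/measurable_EFinP; exact: measurable_onem_cos.
- exact: measurable_funeM.
- move=> y _ /=; rewrite ger0_norm// lee_fin.
  have /andP[_ h1] := onem_cos_le (u * y); have h2 := cos_geN1 (u * y).
  have := sqr_ge0 u; have := sqr_ge0 y; rewrite exprMn in h1.
  by case: (leP (y ^+ 2) 1); nra.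
Qed.

(** Monotone convergence along the growing sets of jumps above the level; they miss only the origin,
    where the integrand vanishes. *)
Let exponent_cvg u : t * exponent u k @[k --> \oo] --> t * \int[nu]_y (1 - cos (u * y)).
Proof.
apply: cvgMr.
pose F k : set (measurableTypeR R) := [set y : R | trunc_level k < `|y|].
have mEF : measurable_fun setT (fun y : R => (1 - cos (u * y))%:E).
  exact/measurable_EFinP.
have UF : \bigcup_k F k = ~` [set 0].
  apply/seteqP; split => y /=.
    by move=> [k _]; rewrite /F/= => /(lt_trans (level_gt0 k)); rewrite normr_gt0 => /eqP.
  move/eqP; rewrite -normr_gt0 => y0.
  have ey0 : 0 <= eta / `|y| by rewrite divr_ge0// ltW.
  have /andP[_ lt1] := truncn_itv ey0.
  exists (Num.trunc (eta / `|y|)) => //; rewrite /F/=.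
  move: lt1; set k := Num.trunc _.
  rewrite ltr_pdivrMr// ltr_pdivrMr// => /lt_le_trans; apply.
  by rewrite mulrC ler_pM2l// ler_nat.
have ndF : nondecreasing_seq F.
  move=> i j ij; apply/subsetPset => y; rewrite /F/=; apply: le_lt_trans.
  by rewrite ler_pM2l// lef_pV2 ?posrE// ler_nat.
have f0 i y : F i y -> (0 <= (1 - cos (u * y))%:E)%E by rewrite lee_fin.
have := @ge0_nondecreasing_set_cvg_integral _ _ _ F _ nu ndF
  (fun i => measurable_norm_gt _) (fun i => measurable_funTS mEF)
  f0.
rewrite UF.
have -> : (\int[nu]_(x in ~` [set 0%R]) (1 - cos (u * x))%:E =
    \int[nu]_x (1 - cos (u * x))%:E)%E.
  rewrite -[in RHS](setUv [set 0%R]) ge0_integral_setU//.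
  - by rewrite [X in (X + _)%E]integral0_eq ?add0e// => x /= ->; rewrite mulr0 cos0 subrr.
  - exact: measurableC.
  - exact: measurable_funTS.
  - by apply/disj_setPS; rewrite setICr.
have fi : (\int[nu]_x (1 - cos (u * x))%:E)%E \is a fin_num.
  exact: (integrable_fin_num measurableT (integrable_levy_onem_cos u)).
by rewrite -(fineK fi) => /fine_cvg.
Qed.

Lemma walk_cos_cvg u : walk k (fun x => cos (u * x)) @[k --> \oo] -->
  expR (t * \int[nu]_y (cos (u * y) - 1)).
Proof.
have -> : t * \int[nu]_y (cos (u * y) - 1) = - (t * \int[nu]_y (1 - cos (u * y))).
  have -> : \int[nu]_y (cos (u * y) - 1) = -1 * \int[nu]_y (1 - cos (u * y)).
    rewrite -RintegralZl//; last exact: integrable_levy_onem_cos.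
    by apply: eq_Rintegral => y _; rewrite mulN1r opprB.
  by rewrite mulN1r mulrN.
have c1 : expR (- (t * exponent u k)) @[k --> \oo] -->
    expR (- (t * \int[nu]_y (1 - cos (u * y)))).
  apply: continuous_cvg; first exact: continuous_expR.
  by apply: cvgN; exact: exponent_cvg.
have c2 : (walk k (fun x => cos (u * x)) - expR (- (t * exponent u k))) @[k --> \oo] --> (0 : R).
  apply/norm_cvg0P.
  apply: (@squeeze_cvgr _ _ _ _ (fun=> 0) (fun k => 4 * harmonic k)).
  - by apply: nearW => k; rewrite normr_ge0/= walk_cos.
  - exact: cvg_cst.
  - by rewrite -[X in _ --> X](mulr0 4); apply: cvgMr; exact: cvg_harmonic.
rewrite -[X in _ --> X]add0r.
have -> : (fun k => walk k (fun x => cos (u * x))) =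
    (fun k => walk k (fun x => cos (u * x)) - expR (- (t * exponent u k)) +
      expR (- (t * exponent u k))).
  by apply/funext => k; rewrite subrK.
exact: cvgD c2 c1.
Qed.

(** * Bounds on the walks, uniform in the truncation level *)

Section Estimates.
Context (s2 : R)
  (s2_bound : forall k, (\int[nu]_(y in shell (trunc_level k) eta) (y ^+ 2)%:E <= s2%:E)%E).
Local Notation massB := (fine (big_jumps setT)).

Let massB0 : 0 <= massB. Proof. exact: fine_ge0. Qed.

Let var_le k : 0 <= \int[small_jumps k]_y y ^+ 2 <= s2.
Proof.
rewrite Rintegral_ge0/=; last by move=> y _; exact: sqr_ge0.
rewrite -lee_fin /Rintegral ge0_integral_mfrestr.
- rewrite fineK// ge0_fin_numE; first by rewrite (le_lt_trans (s2_bound k))// ltry.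
  by apply: integral_ge0 => y _; rewrite lee_fin sqr_ge0.
- by apply/measurable_EFinP; exact: measurable_funX.
- by move=> y; rewrite lee_fin sqr_ge0.
Qed.

Let step_time_le k : (steps k)%:R * step_time k <= t.
Proof. by rewrite -[leRHS](total_time k) ler_wpM2r// ler_nat. Qed.

Let quad_le k K : 0 <= K ->
  (steps k)%:R * (K * step_time k * \int[small_jumps k]_y y ^+ 2) <= K * t * s2.
Proof.
move=> K0; have /andP[v0 v2] := var_le k.
have -> : (steps k)%:R * (K * step_time k * \int[small_jumps k]_y y ^+ 2) =
  K * ((steps k)%:R * step_time k) * \int[small_jumps k]_y y ^+ 2 by ring.
have np0 : 0 <= (steps k)%:R * step_time k by rewrite mulr_ge0// step_time_ge0.
by apply: ler_pM => //; [exact: mulr_ge0|exact: ler_wpM2l].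
Qed.

(* Chernoff bound with [expR (u * eta) = v^-1]. *)
Let small_walk_tail k eps : 2 * eta <= eps -> 0 < t * s2 / eta ^+ 2 <= 1 ->
  iter (steps k).+1 (step_small (small_jumps k) big_jumps (step_time k))
    \1_[set x | eps < `|x|] 0 <= 2 * expR (1 / 2) * (t * s2 / eta ^+ 2) ^+ 2.
Proof.
move=> eps2; set v := t * s2 / eta ^+ 2 => /andP[v0 v1].
have bg : bounded_measurable (\1_[set x | eps < `|x|] : R -> R).
  by apply: bmf_indic; exact: measurable_norm_gt.
have /andP[var0 var2] := var_le k.
(* For [v = 1] the Chernoff parameter would be 0, but then the bound exceeds 1. *)
move: v1; rewrite le_eqVlt => /predU1P[->|v1].
  rewrite expr1n mulr1 (@le_trans _ _ 1)//.
    by apply: iter_step_small_le_cst.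
  by have := expR_ge1Dx (1 / 2 : R); lra.
have vV1 : 1 < v^-1 by rewrite invf_gt1.
pose u := ln v^-1 / eta.
have u0 : 0 < u by rewrite divr_gt0// ln_gt0.
have euv : expR (u * eta) = v^-1.
  by rewrite /u divfK ?gt_eqF// lnK// posrE invr_gt0.
(* Cutting the jumps at no more than half the threshold pays off here: [2 * eta <= eps] produces the
   square of [v], hence an error of order [t ^ 2]. *)
have ceps : v^-1 ^+ 2 / 2 <= cosh (u * eps).
  apply: le_trans (cosh_ge_expR _); rewrite ler_pM2r// -euv expr2 -expRD ler_expR.
  by rewrite -mulrDr ler_pM2l//; lra.
have K0 : 0 <= (cosh (u * eps))^-1 by rewrite invr_ge0 ltW// cosh_gt0.
have gK x : \1_[set x | eps < `|x|] x <= (cosh (u * eps))^-1 * cosh (u * x).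
  rewrite indicE; case: (boolP (x \in _)) => [|_]; last first.
    by rewrite mulr_ge0// ltW// cosh_gt0.
  rewrite inE /= => xe; rewrite mulrC ler_pdivlMr ?cosh_gt0// mul1r.
  rewrite -(cosh_norm (u * x)) normrM (gtr0_norm u0) ler_cosh//.
    by rewrite mulr_ge0 ?(ltW u0)// (le_trans _ eps2)// mulr_ge0// ltW.
  by rewrite ler_pM2l// ltW.
apply: (le_trans (iter_step_small_cosh (step_time_ge0 k) (step_mass k)
  (small_jumps_sym k) (small_jumps_ae k) _ eta0 K0 u0 bg gK 0)).
have cosh0 : cosh (u * 0) = 1 by rewrite mulr0 /cosh oppr0 expR0; field.
rewrite cosh0 mulr1 total_time [leRHS]mulrAC ler_pM ?expR_ge0//; last first.
  rewrite ler_expR (@le_trans _ _ (v * (cosh (u * eta) - 1)))//.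
    have c1 : 0 <= cosh (u * eta) - 1 by rewrite cosh_half mulr_ge0// sqr_ge0.
    rewrite mulrA ler_wpM2r//.
    by rewrite /v -mulrA ler_pM2l// ler_pM2r// invr_gt0 exprn_gt0.
  (* At most [1 / 2] since [v < 1], whence the factor [expR (1 / 2)]. *)
  have -> : v * (cosh (u * eta) - 1) = (1 + v ^+ 2) / 2 - v.
    by rewrite /cosh expRN euv; field; rewrite gt_eqF.
  have := ler_wpM2l (ltW v0) (ltW v1); rewrite expr2; lra.
have -> : 2 * v ^+ 2 = (v^-1 ^+ 2 / 2)^-1 by field; rewrite gt_eqF.
by rewrite lef_pV2 ?posrE ?cosh_gt0// divr_gt0// exprn_gt0// invr_gt0.
Qed.

(** The three summands come from paths with no big jump, with exactly one, and with at least two. *)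
Lemma walk_upper k eps h0 K : 2 * eta <= eps -> 0 < t * s2 / eta ^+ 2 <= 1 ->
  0 <= h0 -> 0 <= K ->
  (forall x, convol big_jumps \1_[set x | eps < `|x|] x <= K * x ^+ 2 + h0) ->
  walk k \1_[set x | eps < `|x|] <=
    2 * expR (1 / 2) * (t * s2 / eta ^+ 2) ^+ 2 + t * (h0 + K * t * s2) + (t * massB) ^+ 2 / 2.
Proof.
move=> eps2 v01 h00 K0 hK.
have bg : bounded_measurable (\1_[set x | eps < `|x|] : R -> R).
  by apply: bmf_indic; exact: measurable_norm_gt.
have g01 (x : R) : 0 <= (\1_[set x | eps < `|x|] x : R) <= 1.
  by rewrite indicE; case: (_ \in _) => /=; rewrite ?lexx ?ler01.
have := iter_step_le_one_jump (step_time_ge0 k) (step_mass k) (steps k) bg g01 0.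
move/le_trans; apply.
rewrite total_time lerD2r lerD//; first exact: small_walk_tail.
rewrite ler_pM2l//.
have := iter_step_small_quad (step_time_ge0 k) (step_mass k)
  (small_jumps_sym k) (small_jumps_ae k) (steps k) K0 h00 (convol_bmf big_jumps bg) hK 0.
move/le_trans; apply.
by rewrite expr0n/= mulr0 add0r lerD2l quad_le.
Qed.

(** Only paths with exactly one big jump are kept. The loss [t * massB ^+ 2] is the chance that the
    other steps contain a big jump, times the bound [massB] on [h1]. *)
Lemma walk_lower k g h1 K : bounded_measurable g -> (forall x, 0 <= g x) ->
  0 <= K -> h1 <= massB ->
  (forall x, h1 - K * x ^+ 2 <= convol big_jumps g x) ->
  t * (h1 - t * massB ^+ 2 - K * t * s2) <= walk k g.
Proof.
move=> bg g0 K0 h1B hK.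
have := iter_step_ge_one_jump (step_time_ge0 k) (step_mass k) (steps k) bg g0 0.
apply: le_trans; rewrite total_time ler_pM2l//.
have bB := convol_bmf big_jumps bg.
set n := steps k; set p := step_time k.
(* The quadratic estimate is an upper bound, so it is applied to the deficit of [convol big_jumps g]
   below [h1]. *)
have bh : bounded_measurable (fun x => h1 + -1 * convol big_jumps g x).
  by apply: bmfD; [exact: bmf_cst|exact: bmfZ].
have hh x : h1 + -1 * convol big_jumps g x <= K * x ^+ 2 + 0.
  by have := hK x; lra.
have := iter_step_small_quad (step_time_ge0 k) (step_mass k)
  (small_jumps_sym k) (small_jumps_ae k) n K0 (lexx 0) bh hh 0.
rewrite iter_step_small_lin//; last exact: bmf_cst.
rewrite iter_step_small_cst expr0n/= mulr0 !add0r mulN1r => H.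
have {}H := le_trans H (quad_le k K0).
have pB0 : 0 <= p * massB by rewrite mulr_ge0// step_time_ge0.
have pB1 : p * massB <= 1.
  apply: le_trans (step_mass k); rewrite ler_wpM2l ?step_time_ge0// lerDr.
  exact: fine_ge0.
have r1 : (1 - p * massB) ^+ n <= 1 by rewrite exprn_ile1 ?subr_ge0// gerBl.
have rn : 1 - n%:R * (p * massB) <= (1 - p * massB) ^+ n.
  by apply: bernoulli_ineq; rewrite pB0.
have np : n%:R * (p * massB) <= t * massB by rewrite mulrA ler_wpM2r// step_time_le.
set r := (1 - p * massB) ^+ n in H r1 rn.
have : (1 - r) * h1 <= (1 - r) * massB by rewrite ler_wpM2l// subr_ge0.
have : (1 - r) * massB <= t * massB * massB by rewrite ler_wpM2r//; lra.
rewrite expr2; move: H; rewrite -/n -/p; lra.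
Qed.

End Estimates.

End ApproximatingWalk.

(** * Small-time bounds *)

Section SmallTime.
Context {R : realType} {d : measure_display} {T : measurableType d} (P : probability T R).
Context (nu : {measure set (measurableTypeR R) -> \bar R}) (f : R -> R) (Y : {RV P >-> R}).
Context (nu_levy : levy_measure nu) (nu_sym : symmetric_measure nu)
  (nu_f : has_density nu f).
Context (eta t eps s2 K : R) (eta0 : 0 < eta) (t0 : 0 < t) (eps2 : 2 * eta <= eps)
  (K0 : 0 <= K).
Context (Y_cos : forall u, \int[P]_w cos (u * Y w) =
    expR (t * \int[nu]_y (cos (u * y) - 1)))
  (s2_bound : forall d, 0 < d -> d < eta ->
    (\int[nu]_(y in shell d eta) (y ^+ 2)%:E <= s2%:E)%E)
  (v01 : 0 < t * s2 / eta ^+ 2 <= 1)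
  (jump_quad : forall x,
    `|fine (nu ([set y : R | eps < `|x + y|] `&` [set y | eta < `|y|])) -
      fine (nu [set y : R | eps < `|y|])| <= K * x ^+ 2).

Local Notation big := (big_jumps nu_levy eta0).
Local Notation tail_eps := (fine (nu [set y : R | eps < `|y|])).
Local Notation tail_eta := (fine (nu [set y : R | eta < `|y|])).
Local Notation prob := (fine (P [set w | eps < `|Y w|])).

Let big_mass : fine (big setT) = tail_eta.
Proof. by rewrite /big_jumps/= /mfrestr /mrestr setTI. Qed.

Let eps0 : 0 <= eps. Proof. by apply: le_trans eps2; rewrite mulr_ge0// ltW. Qed.

Let convol_big x :
  convol big \1_[set z | eps < `|z|] x =
  fine (nu ([set y : R | eps < `|x + y|] `&` [set y | eta < `|y|])).
Proof. by rewrite convol_indic//; exact: measurable_norm_gt. Qed.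

Let tails_le : tail_eps <= tail_eta.
Proof.
have fin e : 0 < e -> nu [set y : R | e < `|y|] \is a fin_num.
  by move=> e0; rewrite ge0_fin_numE// (levy_tail_fin e0).
have eta_eps : eta <= eps by apply: le_trans eps2; rewrite ler_peMl ?ler1n ?(ltW eta0).
apply: fine_le; [exact/fin/(lt_le_trans eta0)|exact: fin|].
apply: le_measure; rewrite ?inE; [exact: measurable_norm_gt|exact: measurable_norm_gt|].
by move=> y /=; exact: le_lt_trans.
Qed.

Let s2_level k : (\int[nu]_(y in shell (eta / k.+2%:R) eta) (y ^+ 2)%:E <= s2%:E)%E.
Proof.
apply: s2_bound; first by rewrite divr_gt0.
by rewrite ltr_pdivrMr// ltr_pMr// ltr1n.
Qed.

Let ts2 : 0 < t * s2.
Proof. by have /andP[+ _] := v01; rewrite pmulr_lgt0// invr_gt0 exprn_gt0. Qed.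

Let L := walk nu_levy t eta0.

Let L_cos u : L k (fun x => cos (u * x)) @[k --> \oo] --> \int[P]_w cos (u * Y w).
Proof. by rewrite Y_cos; exact: walk_cos_cvg. Qed.

Let L_lin k a g h : bounded_measurable g -> bounded_measurable h ->
  L k (fun x => g x + a * h x) = L k g + a * L k h.
Proof. exact: walk_lin. Qed.

Let L_le k g h : bounded_measurable g -> bounded_measurable h ->
  (forall x, g x <= h x) -> L k g <= L k h.
Proof. exact: walk_le. Qed.

Let L_cst k c : L k (fun=> c) = c.
Proof. exact: walk_cst. Qed.

Lemma small_time_upper :
  prob <= 2 * expR (1 / 2) * (t * s2 / eta ^+ 2) ^+ 2 +
    t * (tail_eps + K * t * s2) + (t * tail_eta) ^+ 2 / 2.
Proof.
apply: (limit_prob_le L_lin L_le L_cst L_cos eps0) => k.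
rewrite -big_mass; apply: walk_upper => //.
by move=> x; have := jump_quad x; rewrite -convol_big ler_norml => /andP[_]; lra.
Qed.

Lemma small_time_lower : t * (tail_eps - t * tail_eta ^+ 2 - K * t * s2) <= prob.
Proof.
apply/ler_addgt0Pr => e' e'0.
have c0 : 0 < t * (2 + t * s2) by rewrite mulr_gt0// addr_gt0.
(* The shell lowers [tail_eps] by [2 * e] and raises [K] by [e], which costs
   [t * (2 * e + e * t * s2) = e'] in all. *)
pose e := e' / (t * (2 + t * s2)).
have e0 : 0 < e by rewrite divr_gt0.
have [b [c [epsb bc Hin]]] :=
  inner_approximation (mfrestr_density (measurable_norm_gt eta : measurable (_ : set (measurableTypeR R)))
    (levy_tail_fin eta0 nu_levy) nu_f) eps0 e0.
have bg : bounded_measurable (\1_[set z | b <= `|z| <= c] : R -> R).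
  by apply: bmf_indic; exact: measurable_norm_itv.
have ab : 0 <= eps < b by rewrite eps0.
have : t * ((tail_eps - 2 * e) - t * tail_eta ^+ 2 - (K + e) * t * s2) <= prob.
  apply: (limit_prob_ge L_lin L_le L_cst L_cos ab bc bg).
    move=> x; rewrite indicE.
    have -> : (x \in [set z | b <= `|z| <= c]) = (b <= `|x| <= c).
      by apply/idP/idP; rewrite inE.
    by rewrite lexx andbT.
  move=> k; rewrite -big_mass; apply: walk_lower => //.
  - by rewrite addr_ge0// ltW.
  - by rewrite big_mass; have := tails_le; lra.
  - move=> x; have := Hin x; rewrite -/(big_jumps nu_levy eta0) convol_big.
    by have := jump_quad x; rewrite ler_norml => /andP[+ _]; lra.
have : e * (t * (2 + t * s2)) = e' by rewrite /e divfK// gt_eqF.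
lra.
Qed.

End SmallTime.

(** * Comparison with the explicit constants *)

Section Numerics.
Context {R : realType}.

(** The numbers are the multiples of [v ^ 2] spent in [error_terms]: [1 / 8] covers [v * w / 2], 4
    completes the square of [2 * v + y - l], and 8 covers [8 * v * y] with [y <= v]. *)
Lemma expR_constant : 2 * expR (1 / 2) + 1 / 8 + 12 <= 2 * expR (2 + (expR 1)^-1) :> R.
Proof.
have E : 5 / 4 <= expR (1 / 4) :> R by have := expR_ge1Dx (1 / 4 : R); lra.
have E2 : expR (1 / 2) = expR (1 / 4) ^+ 2 :> R by rewrite -expRM_natl; congr expR; field.
have E1 : expR 1 = expR (1 / 2) ^+ 2 :> R by rewrite -expRM_natl; congr expR; field.
have E4 : expR 2 = expR (1 / 2) ^+ 4 :> R by rewrite -expRM_natl; congr expR; field.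
have z0 : 25 / 16 <= expR (1 / 2) :> R.
  by rewrite E2 expr2; nra.
(* With [z = expR (1 / 2)], the right-hand exponential is at least
   [z ^ 4 * (1 + z ^ -2) = z ^ 4 + z ^ 2], which leaves a polynomial inequality for
   [z >= 25 / 16]. *)
rewrite expRD E4.
have := expR_ge1Dx ((expR 1)^-1 : R); rewrite E1.
move: (expR (1 / 2)) z0 => z z0.
have z4 : 0 <= z ^+ 4 by rewrite exprn_ge0//; lra.
move=> /(ler_wpM2l z4).
have -> : z ^+ 4 * (1 + (z ^+ 2)^-1) = z ^+ 4 + z ^+ 2.
  by field; rewrite gt_eqF//; lra.
have z2 : 5 / 2 * z - 25 / 16 <= z ^+ 2 by have := sqr_ge0 (z - 5 / 4); rewrite !expr2; lra.
have : (25 / 16) ^+ 2 <= z ^+ 2 by rewrite lerXn2r ?nnegrE//; lra.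
have -> : z ^+ 4 = (z ^+ 2) ^+ 2 by rewrite -exprM.
move: (z ^+ 2) z2 => q z2 q2.
have : 0 <= (q - (25 / 16) ^+ 2) ^+ 2 by exact: sqr_ge0.
rewrite !expr2; rewrite !expr2 in q2; lra.
Qed.

(* AM-GM absorbs the products of [l] with [v] and [y]. *)
Lemma error_terms (v y l w E C : R) : 0 <= l -> 0 <= y -> y <= v -> 0 <= w -> w <= v / 4 ->
  2 * E + 1 / 8 + 12 <= 2 * C ->
  2 * E * v ^+ 2 + v * (w / 2 + 4 * (y + l)) + (y + l) ^+ 2 <=
  2 * C * v ^+ 2 + 2 * y ^+ 2 + 2 * l ^+ 2.
Proof.
move=> l0 y0 yv w0 wv EC.
have v0 : 0 <= v by lra.
have : 0 <= (2 * v + y - l) ^+ 2 by exact: sqr_ge0.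
have := ler_wpM2r (sqr_ge0 v) EC.
have := ler_wpM2l v0 yv; have := ler_wpM2l v0 wv.
rewrite !expr2; lra.
Qed.

End Numerics.

(** The Lipschitz interval is centred at [eps] with radius [eps - 3 / 4 * a]. Displacements below
    this radius fall under [two_tails_quad]; larger ones have [|x| >= a / 4], so the trivial bound
    [lambda f (a / 2)] is at most [16 * lambda f (a / 2) * x ^ 2 / a ^ 2]. *)
Lemma jump_quad_bound {R : realType} (nu : {measure set (measurableTypeR R) -> \bar R})
    (f : R -> R) (a eps Lip : R) :
  levy_measure nu -> symmetric_measure nu -> has_density nu f ->
  0 < a -> a <= eps -> 0 <= Lip ->
  (forall y, `|y - eps| < eps - 3 / 4 * a -> `|f y - f eps| <= Lip * `|y - eps|) ->
  forall x, `|fine (nu ([set y : R | eps < `|x + y|] `&` [set y | a / 2 < `|y|])) -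
      fine (nu [set y : R | eps < `|y|])| <=
    (2 * Lip + 16 * lambda f (a / 2) / a ^+ 2) * x ^+ 2.
Proof.
move=> nuL nuS nuf a0 ae Lip0 fLip x.
set eta := a / 2; set la := lambda f eta.
have eta0 : 0 < eta by rewrite divr_gt0.
have eps0 : 0 < eps by exact: lt_le_trans ae.
have lE r : lambda f r = fine (nu [set y | r < `|y|]) by exact: lambdaE.
have la0 : 0 <= la by apply: Rintegral_ge0 => y _; case: nuf.
have cla0 : 0 <= 16 * la / a ^+ 2 by rewrite divr_ge0 ?sqr_ge0// mulr_ge0.
have x20 : 0 <= x ^+ 2 by exact: sqr_ge0.
have [xr|xr] := ltrP `|x| (eps - 3 / 4 * a).
  apply: (@le_trans _ _ (2 * Lip * x ^+ 2)); last first.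
    by rewrite ler_wpM2r// lerDl.
  by apply: (two_tails_quad nuL nuS nuf eta0 Lip0 _ xr fLip); rewrite /eta; lra.
have mA : measurable ([set y : R | eps < `|x + y|] `&` [set y | eta < `|y|]).
  apply: measurableI; last exact: measurable_norm_gt.
  exact: (measurable_translate x (measurable_norm_gt eps)).
have etaoo := levy_tail_fin eta0 nuL; have epsoo := levy_tail_fin eps0 nuL.
have le1 : fine (nu ([set y : R | eps < `|x + y|] `&` [set y | eta < `|y|])) <= la.
  rewrite /la lE; apply: fine_le; [|by rewrite ge0_fin_numE|].
    rewrite ge0_fin_numE//; apply: le_lt_trans etaoo.
    by apply: le_measure; rewrite ?inE; [exact: mA|exact: measurable_norm_gt|exact: subIsetr].
  by apply: le_measure; rewrite ?inE; [exact: mA|exact: measurable_norm_gt|exact: subIsetr].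
have le2 : fine (nu [set y : R | eps < `|y|]) <= la.
  rewrite /la lE; apply: fine_le; [by rewrite ge0_fin_numE|by rewrite ge0_fin_numE|].
  apply: le_measure; rewrite ?inE; [exact: measurable_norm_gt|exact: measurable_norm_gt|].
  by move=> y /=; apply: le_lt_trans; rewrite /eta; lra.
have : 0 <= fine (nu ([set y : R | eps < `|x + y|] `&` [set y | eta < `|y|])) by exact: fine_ge0.
have : 0 <= fine (nu [set y : R | eps < `|y|]) by exact: fine_ge0.
move=> g1 g2; apply: (@le_trans _ _ la); first by rewrite ler_norml; lra.
apply: (@le_trans _ _ (16 * la / a ^+ 2 * x ^+ 2)); last first.
  by rewrite ler_wpM2r// lerDr mulr_ge0.
have : (a / 4) ^+ 2 <= x ^+ 2.
  rewrite -[leRHS]real_normK ?num_real// lerXn2r ?nnegrE// ?divr_ge0 ?(ltW a0)//.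
  by lra.
have -> : 16 * la / a ^+ 2 * x ^+ 2 = la * (16 * x ^+ 2 / a ^+ 2) by ring.
move=> ax; rewrite ler_peMr// ler_pdivlMr ?exprn_gt0//.
by move: ax; rewrite expr_div_n; lra.
Qed.

(** Everything is expressed through [v = q / (2 - alpha)], the normalized variance of the small
    jumps, [q / alpha], which bounds [t] times the mass of jumps between [a / 2] and 1, and
    [t * lambda f 1]. These are the [v], [y] and [l] of [error_terms]. *)
Lemma small_time_bound {R : realType} {d : measure_display} {T : measurableType d}
    (P : probability T R) (nu : {measure set (measurableTypeR R) -> \bar R})
    (f : R -> R) (M alpha : R) (X : R -> {RV P >-> R}) (eps t : R) :
  1 <= alpha < 2 ->
  levy_measure nu -> symmetric_measure nu -> has_density nu f ->
  0 < M -> class_L M alpha f -> pure_jump_levy_process nu X -> 0 < eps ->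
  (M * (Num.min eps 1) `^ (- (2 + alpha))).-lipschitz_
    `]3 / 4 * Num.min eps 1, 2 * eps - 3 / 4 * Num.min eps 1[ f ->
  0 < t <= (2 - alpha) * (Num.min 1 eps) `^ alpha / (2 `^ (1 + alpha) * M) ->
  `| fine (P [set w | eps < `|X t w|]) - lambda f eps * t | <=
  t ^+ 2 * M ^+ 2 * (2 * K1 alpha * ((Num.min eps 1) `^ (- alpha)) ^+ 2)
  + 2 * t ^+ 2 * lambda f 1 ^+ 2.
Proof.
move=> /andP[al1 al2] nuL nuS nuf M0 fL [_ char] eps0 fLip /andP[t0 tle].
rewrite (minC 1 eps) in tle.
have a0 : 0 < Num.min eps 1 by rewrite lt_min eps0 ltr01.
have a1 : Num.min eps 1 <= 1 by rewrite ge_min lexx orbT.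
have ae : Num.min eps 1 <= eps by rewrite ge_min lexx.
move: (Num.min eps 1) a0 a1 ae fLip tle => a a0 a1 ae fLip tle.
have al0 : 0 < alpha by lra.
have al2' : 0 < 2 - alpha by lra.
pose eta := a / 2.
have eta0 : 0 < eta by rewrite divr_gt0.
pose s2 := 2 * M * eta `^ (2 - alpha) / (2 - alpha).
pose la := lambda f eta.
pose Lip := M * a `^ (- (2 + alpha)).
have Lip0 : 0 <= Lip by rewrite /Lip mulr_ge0 ?powR_ge0// ltW.
have la0 : 0 <= la by apply: Rintegral_ge0 => x _; case: nuf.
pose K := 2 * Lip + 16 * la / a ^+ 2.
have cla0 : 0 <= 16 * la / a ^+ 2 by rewrite divr_ge0 ?sqr_ge0// mulr_ge0.
have K0 : 0 <= K by rewrite /K addr_ge0// mulr_ge0.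
pose w := t * M * a `^ (- alpha).
have w0 : 0 < w by rewrite /w !mulr_gt0 ?powR_gt0.
pose q := 2 `^ (1 + alpha) * w.
have q0 : 0 < q by rewrite /q mulr_gt0 ?powR_gt0.
have powa r : a `^ (- r) = (a `^ r)^-1 by rewrite powRN.
have etaN : eta `^ (- alpha) = 2 `^ alpha * a `^ (- alpha).
  have h2 : 2^-1 `^ (- alpha) = 2 `^ alpha :> R.
    by rewrite -(powR_inv1 (ler0n R 2)) -powRrM mulrNN mul1r.
  by rewrite /eta powRM ?(ltW a0)// h2 mulrC.
have two : 2 `^ (1 + alpha) = 2 * 2 `^ alpha :> R.
  by rewrite powRD ?powRr1// pnatr_eq0 implybT.
have eta2 : eta `^ (2 - alpha) = eta ^+ 2 * eta `^ (- alpha).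
  by rewrite powRD ?powR_mulrn ?(ltW eta0)// (gt_eqF eta0) implybT.
have vE : t * s2 / eta ^+ 2 = q / (2 - alpha).
  rewrite /s2 eta2 etaN /q two /w; field.
  by rewrite !gt_eqF.
(* This is the restriction on [t], rewritten. *)
have v1 : q / (2 - alpha) <= 1.
  rewrite ler_pdivrMr// mul1r /q /w powa.
  rewrite ler_pdivlMr ?mulr_gt0 ?powR_gt0// in tle.
  rewrite !mulrA ler_pdivrMr ?powR_gt0//.
  by move: tle; set x := 2 `^ _; set y := a `^ _; lra.
have v01 : 0 < t * s2 / eta ^+ 2 <= 1 by rewrite vE v1 divr_gt0.
have eps2 : 2 * eta <= eps by rewrite /eta; lra.
have Ycos u : \int[P]_w0 cos (u * X t w0) = expR (t * \int[nu]_y (cos (u * y) - 1)).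
  by have [] := char t u (ltW t0).
have s2b e : 0 < e -> e < eta ->
    (\int[nu]_(y in shell e eta) (y ^+ 2)%:E <= s2%:E)%E.
  move=> e0 ee; apply: (shell_variance nuL nuS nuf M0 fL al2) => //.
  by rewrite /eta; lra.
have lE r : lambda f r = fine (nu [set y | r < `|y|]) by exact: lambdaE.
have fLip' y : `|y - eps| < eps - 3 / 4 * a -> `|f y - f eps| <= Lip * `|y - eps|.
  move=> ye; have := fLip (y, eps); apply; split => /=; rewrite in_itv/=; last lra.
  by move: ye; rewrite ltr_norml; lra.
have quad := jump_quad_bound nuL nuS nuf a0 ae Lip0 fLip'.
rewrite -/eta -/la -/K in quad.
have := small_time_upper nuL nuS eta0 t0 eps2 K0 Ycos s2b v01 quad.
have := small_time_lower nuL nuS nuf eta0 t0 eps2 K0 Ycos s2b v01 quad.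
rewrite -!lE -/la vE.
set p := fine _; set v := q / (2 - alpha) => lower upper.
have l0 : 0 <= lambda f 1 by apply: Rintegral_ge0 => x _; case: nuf.
have lale : t * la <= q / alpha + t * lambda f 1.
  have := lambda_le nuL nuS nuf M0 fL al0 eta0.
  rewrite -/la etaN => /(_ _)/(ler_wpM2l (ltW t0)) H.
  apply: le_trans (H _) _; first by rewrite /eta; lra.
  rewrite mulrDr lerD2r /q two /w le_eqVlt; apply/orP; left; apply/eqP.
  by field; rewrite gt_eqF.
(* Here [1 <= alpha] enters, as [2 - alpha <= alpha]. *)
have yv : q / alpha <= v.
  by rewrite /v ler_pM2l// lef_pV2 ?posrE//; lra.
(* Again from [1 <= alpha]: [2 ^ (1 + alpha) >= 4] and [2 - alpha <= 1]. *)
have wv : w <= v / 4.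
  have twoge : 4 <= 2 `^ (1 + alpha) :> R.
    have -> : 4 = 2 `^ 2 :> R by rewrite powR_mulrn// expr2 -natrM.
    by apply: ler_powR; move: al1; clear; lra.
  have qw : 4 * w <= q by rewrite /q ler_wpM2r// ltW.
  have qv : q <= v by rewrite /v ler_pdivlMr// ler_piMr ?(ltW q0)//; lra.
  lra.
have ts2 : t * s2 = v * (a ^+ 2 / 4).
  have -> : t * s2 = t * s2 / eta ^+ 2 * eta ^+ 2 by field; rewrite gt_eqF.
  by rewrite vE -/v /eta expr_div_n -natrX.
(* The two parts of [K] separate: the Lipschitz constant gives [w / 2], the far displacements give
   [4 * (t * la)]. *)
have tK : t * (K * t * s2) = v * (w / 2 + 4 * (t * la)).
  have -> : t * (K * t * s2) = t * K * (t * s2) by ring.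
  have LipE : Lip * a ^+ 2 = M * a `^ (- alpha).
    rewrite /Lip -mulrA; congr (_ * _); rewrite -(powR_mulrn 2 (ltW a0)) -powRD.
      by congr (_ `^ _); ring.
    by rewrite (gt_eqF a0) implybT.
  rewrite ts2 /K; have -> : t * (2 * Lip + 16 * la / a ^+ 2) * (v * (a ^+ 2 / 4)) =
    v * (t * (Lip * a ^+ 2) / 2 + 4 * (t * la)) by field; rewrite gt_eqF.
  by rewrite LipE /w; congr (v * (_ + _)); ring.
have v0 : 0 <= v by rewrite ltW// divr_gt0.
have tla0 : 0 <= t * la by rewrite mulr_ge0// ltW.
have y0 : 0 <= q / alpha by rewrite divr_ge0// ltW.
have tl0 : 0 <= t * lambda f 1 by rewrite mulr_ge0// ltW.
have fin := error_terms tl0 y0 yv (ltW w0) wv expR_constant.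
(* Since [4 ^ (1 + alpha)] is the square of [2 ^ (1 + alpha)], the two summands of [K1] are the
   coefficients of [v ^ 2] and of [(q / alpha) ^ 2]. *)
have target : t ^+ 2 * M ^+ 2 * (2 * K1 alpha * (a `^ (- alpha)) ^+ 2) + 2 * t ^+ 2 * lambda f 1 ^+ 2 =
    2 * expR (2 + (expR 1)^-1) * v ^+ 2 + 2 * (q / alpha) ^+ 2 + 2 * (t * lambda f 1) ^+ 2.
  have four : 4 `^ (1 + alpha) = (2 `^ (1 + alpha)) ^+ 2 :> R.
    have -> : 4 = 2 * 2 :> R by rewrite -natrM.
    by rewrite powRM// expr2.
  rewrite /K1 four /v /q /w; field.
  by rewrite !gt_eqF.
rewrite target; apply: le_trans fin.
have m1 : v * (4 * (t * la)) <= v * (4 * (q / alpha + t * lambda f 1)).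
  by rewrite ler_wpM2l// ler_pM2l.
have m2 : (t * la) ^+ 2 <= (q / alpha + t * lambda f 1) ^+ 2.
  by rewrite lerXn2r ?nnegrE// addr_ge0.
have m3 : 0 <= 2 * expR (1 / 2) * v ^+ 2.
  by rewrite mulr_ge0 ?sqr_ge0// mulr_ge0 ?expR_ge0.
have m4 : 0 <= (t * la) ^+ 2 by exact: sqr_ge0.
have E1 : t * (lambda f eps + K * t * s2) = t * lambda f eps + t * (K * t * s2) by ring.
have E2 : t * (lambda f eps - t * la ^+ 2 - K * t * s2) =
  t * lambda f eps - (t * la) ^+ 2 - t * (K * t * s2) by ring.
rewrite E1 tK in upper; rewrite E2 tK in lower.
rewrite (mulrC (lambda f eps)) ler_norml.
by move: lower upper m1 m2 m3 m4; clear; move=> *; apply/andP; split; lra.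
Qed.

(** Stated with inequalities on the constants so that both cases of [alpha] are instances. The term
    in [K1] goes into [F1] if [eps <= 1], where the minimum is [eps], and into [F4] if [1 < eps],
    where it is 1; the other summands are nonnegative. *)
Lemma small_time_bound_constants (R : realType) (alpha : R) (halpha : 1 <= alpha < 2)
    (F1 F2 : R) (F3 : R -> R) (F4 F5 : R) :
  2 * K1 alpha <= F1 -> 0 <= F2 -> (forall eps, 1 < eps -> 0 <= F3 eps) ->
  2 * K1 alpha <= F4 -> 0 <= F5 ->
    forall (d : measure_display) (T : measurableType d) (P : probability T R)
      (nu : {measure set (measurableTypeR R) -> \bar R}) (f : R -> R) (M : R)
      (X : R -> {RV P >-> R}) (eps : R),
      levy_measure nu -> symmetric_measure nu -> has_density nu f ->
      0 < M -> class_L M alpha f ->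
      pure_jump_levy_process nu X ->
      0 < eps ->
      (M * (Num.min eps 1) `^ (- (2 + alpha))).-lipschitz_
        `]3 / 4 * Num.min eps 1, 2 * eps - 3 / 4 * Num.min eps 1[ f ->
      forall t : R,
        0 < t <= (2 - alpha) * (Num.min 1 eps) `^ alpha
                 / (2 `^ (1 + alpha) * M) ->
        `| fine (P [set w | eps < `|X t w|]) - lambda f eps * t | <=
          t ^+ 2 * M ^+ 2
            * ((F1 * eps `^ (- (2 * alpha))
                + lambda f 1 * eps `^ (- alpha) * F2) * (0 < eps <= 1)%R%:R
               + (eps ^+ 2 * F3 eps + F4) * (1 < eps)%R%:R)
          + 2 * t ^+ 2 * lambda f 1 ^+ 2
          + t ^+ 4 * M ^+ 4 * F5 / (Num.min eps 1) `^ (4 * alpha).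
Proof.
move=> hF1 hF2 hF3 hF4 hF5 d T P nu f M X eps nuL nuS nuf M0 fL hX eps0 fLip t ht.
apply: le_trans (small_time_bound halpha nuL nuS nuf M0 fL hX eps0 fLip ht) _.
have l0 : 0 <= lambda f 1 by apply: Rintegral_ge0 => x _; case: nuf.
have tM0 : 0 <= t ^+ 2 * M ^+ 2 by rewrite mulr_ge0// sqr_ge0.
rewrite -[leLHS]addr0 lerD//; last first.
  have /andP[/ltW t0 _] := ht.
  by rewrite divr_ge0 ?powR_ge0// !mulr_ge0 ?exprn_ge0// ltW.
rewrite lerD2r ler_wpM2l// eps0/=.
have [e1|e1] := lerP eps 1.
  rewrite mulr1 mulr0 addr0.
  have -> : eps `^ (- (2 * alpha)) = (eps `^ (- alpha)) ^+ 2.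
    by rewrite -powR_mulrn ?powR_ge0// -powRrM mulNr mulrC.
  rewrite -[leLHS]addr0 lerD//; first by rewrite ler_wpM2r// sqr_ge0.
  by rewrite !mulr_ge0// powR_ge0.
rewrite powR1 expr1n mulr0 add0r !mulr1 -[leLHS]add0r lerD//.
by rewrite mulr_ge0 ?sqr_ge0// hF3.
Qed.

Theorem theorem5 (R : realType) (alpha : R) (halpha : 1 <= alpha < 2) :
  exists (F1 F2 : R) (F3 : R -> R) (F4 F5 : R),
    explicit_constants alpha F1 F2 F3 F4 F5 /\
    forall (d : measure_display) (T : measurableType d) (P : probability T R)
      (nu : {measure set (measurableTypeR R) -> \bar R}) (f : R -> R) (M : R)
      (X : R -> {RV P >-> R}) (eps : R),
      levy_measure nu -> symmetric_measure nu -> has_density nu f ->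
      0 < M -> class_L M alpha f ->
      pure_jump_levy_process nu X ->
      0 < eps ->
      (M * (Num.min eps 1) `^ (- (2 + alpha))).-lipschitz_
        `]3 / 4 * Num.min eps 1, 2 * eps - 3 / 4 * Num.min eps 1[ f ->
      forall t : R,
        0 < t <= (2 - alpha) * (Num.min 1 eps) `^ alpha
                 / (2 `^ (1 + alpha) * M) ->
        `| fine (P [set w | eps < `|X t w|]) - lambda f eps * t | <=
          t ^+ 2 * M ^+ 2
            * ((F1 * eps `^ (- (2 * alpha))
                + lambda f 1 * eps `^ (- alpha) * F2) * (0 < eps <= 1)%R%:R
               + (eps ^+ 2 * F3 eps + F4) * (1 < eps)%R%:R)
          + 2 * t ^+ 2 * lambda f 1 ^+ 2
          + t ^+ 4 * M ^+ 4 * F5 / (Num.min eps 1) `^ (4 * alpha).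
Proof.
have /andP[al1 al2] := halpha.
have al0 : 0 < alpha by lra.
have a2 : 0 < 2 - alpha by lra.
have pow0 (b c : R) : 0 < b -> 0 < b `^ c by move=> b0; exact: powR_gt0.
have K1_0 : 0 < K1 alpha.
  by rewrite /K1 mulr_gt0 ?pow0// addr_gt0// divr_gt0 ?expR_gt0// exprn_gt0.
have K3_0 : 0 < K3 alpha.
  by rewrite /K3 divr_gt0// ?mulr_gt0 ?pow0 ?expR_gt0 ?exprn_gt0.
have K6_0 : 0 < K6 alpha by rewrite /K6 divr_gt0 ?mulr_gt0 ?pow0.
have six : 0 < 6 / alpha ^+ 2 by rewrite divr_gt0 ?exprn_gt0.
have K1d : 0 < 2 * K1 alpha by rewrite mulr_gt0.
have K3d : 0 < 2 * K3 alpha by rewrite mulr_gt0.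
(* [K2] and [K4] divide by [alpha - 1], so [alpha = 1] is separate; there [F1] and [F3] are free and
   are taken to be [2 * K1 alpha] and 1. *)
move: al1; rewrite le_eqVlt => /predU1P[al1|al1].
  have ln2 : 0 < 64 * ln 2 :> R by rewrite mulr_gt0// ln_gt0// ltr1n.
  exists (2 * K1 alpha), (K6 alpha), (fun=> 1), (2 * K1 alpha + 64 * ln 2 + 6 / alpha ^+ 2),
    (2 * K3 alpha); split.
    split; [split=> //| |].
    - by rewrite !addr_gt0.
    - by rewrite -al1 ltxx.
    - by move=> _; split=> //; exists 1.
  apply: small_time_bound_constants => //; try exact: ltW.
  by rewrite -addrA lerDl addr_ge0// ltW.
have a10 : 0 < alpha - 1 by rewrite subr_gt0.
have K2_0 : 0 < K2 alpha by rewrite /K2 divr_gt0 ?mulr_gt0 ?pow0.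
have K2d : 0 < 2 * K2 alpha by rewrite mulr_gt0.
have K4_0 : 0 < K4 alpha.
  by rewrite /K4 !addr_gt0// divr_gt0 ?mulr_gt0 ?pow0 ?exprn_gt0.
have K5_0 eps : 1 < eps -> 0 < K5 alpha eps.
  move=> e1; rewrite /K5 e1/=.
  have [e2|e2] := ltrP eps (3 / 2).
    by rewrite mulr0 addr0 mulr1 addr_gt0// divr_gt0 ?mulr_gt0 ?pow0 ?exprn_gt0.
  by rewrite mulr0 add0r mulr1 divr_gt0 ?mulr_gt0 ?pow0.
exists (2 * K1 alpha + 2 * K2 alpha + K4 alpha + 6 / alpha ^+ 2), (K6 alpha),
  (K5 alpha), (2 * K1 alpha + 2 * K2 alpha + 6 / alpha ^+ 2), (2 * K3 alpha); split.
  split; [split=> //| |].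
  - by move: K1d K2d K4_0 six; lra.
  - by move: K1d K2d six; lra.
  - by [].
  - by move=> al1'; rewrite al1' ltxx in al1.
apply: small_time_bound_constants => //; try exact: ltW.
- by move: K1d K2d K4_0 six; lra.
- by move=> eps /K5_0/ltW.
- by move: K1d K2d six; lra.
Qed.
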